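(* For all integers $n \ge 1$, $$t(n) \ge \frac{1}{2}\binom{n}{2} + \frac{n\ln n}{5} - 3122 .$$ Furthermore, there is an $O(n^2)$ time algorithm that, given a tournament with $n$ vertices, finds a spanning shortcut tree of it with at least $\frac{1}{2}\binom{n}{2} + \frac{n\ln n}{5} - 3122$ shortcuts. On the other hand, for all $n$ sufficiently large, $$t(n) \le \frac{1}{2}\binom{n}{2} + 4n\log^2 n .$$
   Context: A tournament is an orientation of a complete graph (finite and simple); $uv$ denotes an edge directed from $u$ to $v$. Here $\ln$ is the natural logarithm, $\log$ is the base $2$ logarithm, and $\log^2 n = (\log n)^2$. A binary tree is a rooted tree in which every vertex has at most two children: a left child (if it exists) and a right child (if it exists). The left (resp. right) descendants of a vertex are all vertices in the subtree rooted at its left (resp. right) child. A spanning shortcut tree of a tournament $G$ is a binary tree whose vertex set is $V(G)$ such that for every vertex $v$, all left descendants of $v$ are in-neighbors of $v$ in $G$ and all right descendants of $v$ are out-neighbors of $v$ in $G$. The in-order of the tree is the unique ordering of the vertices in which each vertex comes after all its left descendants and before all its right descendants; for a spanning shortcut tree the in-order is a directed Hamiltonian path of $G$. A shortcut of a directed path $v_1 v_2 \cdots v_n$ in $G$ is an edge $v_i v_j$ of $G$ with $j > i+1$. The number of shortcuts of a spanning shortcut tree is the number of shortcuts of the Hamiltonian path given by its in-order. Let $t(n)$ denote the largest integer such that every tournament with $n$ vertices has a spanning shortcut tree with at least $t(n)$ shortcuts. *)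

(* Defs.v *)
From HB Require Import structures.
From mathcomp Require Import all_boot all_order all_algebra.
From mathcomp Require Import all_classical all_reals all_analysis.

Set Implicit Arguments.
Unset Strict Implicit.
Unset Printing Implicit Defensive.

Import Order.TTheory GRing.Theory Num.Theory.

Local Open Scope nat_scope.

Definition tournament (V : finType) (G : rel V) : Prop :=
  irreflexive G /\ forall u v, u != v -> G u v (+) G v u.

Inductive bintree (V : Type) : Type :=
| Leaf
| Node of bintree V & V & bintree V.

Arguments Leaf {V}.

Fixpoint inorder (V : Type) (T : bintree V) : seq V :=
  if T is Node l v r then inorder l ++ v :: inorder r else [::].

(* The left (right) descendants of the vertex v of Node l v r are the entries *)
(* of inorder l (inorder r).                                                  *)
Fixpoint shortcut_tree (V : Type) (G : rel V) (T : bintree V) : bool :=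
  if T is Node l v r then
    [&& all (fun u => G u v) (inorder l), all (fun u => G v u) (inorder r),
        shortcut_tree G l & shortcut_tree G r]
  else true.

Definition spanning (V : finType) (T : bintree V) : bool :=
  perm_eq (inorder T) (enum V).

Definition spanning_shortcut_tree (V : finType) (G : rel V) (T : bintree V) :=
  spanning T && shortcut_tree G T.

Definition path_shortcuts (V : Type) (G : rel V) (p : seq V) : nat :=
  #|[pred ij : 'I_(size p) * 'I_(size p) |
      (ij.1.+1 < ij.2) && G (tnth (in_tuple p) ij.1) (tnth (in_tuple p) ij.2)]|.

Definition shortcuts (V : Type) (G : rel V) (T : bintree V) : nat :=
  path_shortcuts G (inorder T).

Definition always_shortcuts (n k : nat) : Prop :=
  forall (V : finType) (G : rel V), #|V| = n -> tournament G ->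
    exists2 T, spanning_shortcut_tree G T & k <= shortcuts G T.

Lemma shortcut_tree_exists (V : eqType) (G : rel V) (s : seq V) :
  irreflexive G -> (forall u v, u != v -> G u v (+) G v u) -> uniq s ->
  exists2 T, perm_eq (inorder T) s & shortcut_tree G T.
Proof.
move=> irrG totG; have [m] := ubnP (size s).
elim: m s => // m IHm [|v s] /=; first by exists Leaf.
rewrite ltnS => sz_s /andP[vNs uniq_s].
have [l pl tl] : exists2 T,
    perm_eq (inorder T) [seq u <- s | G u v] & shortcut_tree G T.
  apply: IHm; last exact: filter_uniq.
  by rewrite size_filter (leq_ltn_trans (count_size _ _)).
have [r pr tr] : exists2 T,
    perm_eq (inorder T) [seq u <- s | ~~ G u v] & shortcut_tree G T.
  apply: IHm; last exact: filter_uniq.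
  by rewrite size_filter (leq_ltn_trans (count_size _ _)).
exists (Node l v r) => /=.
  rewrite perm_catC /= perm_cons perm_catC.
  by rewrite (permPl (perm_cat pl pr)) perm_filterC.
rewrite tl tr (perm_all _ pl) (perm_all _ pr) filter_all /= andbT.
apply/allP => u; rewrite mem_filter => /andP[NGuv us].
have /totG : u != v by apply: contraNneq vNs => <-.
by rewrite (negbTE NGuv).
Qed.

Lemma always_shortcuts_ex (n : nat) : exists k, `[< always_shortcuts n k >].
Proof.
exists 0; apply/asboolP => V G _ [irrG totG].
have [T pT tT] := shortcut_tree_exists irrG totG (enum_uniq V).
by exists T => //; apply/andP.
Qed.

Lemma always_shortcuts_le (n k : nat) :
  `[< always_shortcuts n k >] -> k <= n * n.
Proof.
move=> /asboolP /(_ 'I_n (fun i j => i < j)) [].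
- exact: card_ord.
- split=> [i|i j]; first exact: ltnn.
  by rewrite -val_eqE /=; case: ltngtP.
move=> T /andP[/perm_size sT _] /leq_trans; apply.
apply: leq_trans (max_card _) _.
by rewrite card_prod !card_ord sT -cardE card_ord.
Qed.

Definition t (n : nat) : nat :=
  ex_maxn (always_shortcuts_ex n) (@always_shortcuts_le n).

Definition log2 (R : realType) (x : R) : R := (ln x / ln 2)%R.

(* Running time is measured on a word RAM, programmed by while programs over  *)
(* finitely many variables and arrays of natural numbers.  Every operation,   *)
(* memory access and control step has unit cost; every value that is computed *)
(* has to fit in a machine word.                                              *)
Inductive binop := OpAdd | OpSub | OpMul | OpDiv | OpEq | OpLt.

Inductive expr :=
| Const of nat
| Var of nat
| Get of nat & expr
| Bin of binop & expr & expr.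

Inductive cmd :=
| Skip
| Assign of nat & expr
| Put of nat & expr & expr
| Seq of cmd & cmd
| If of expr & cmd & cmd
| While of expr & cmd.

Record store := Store { var : nat -> nat; arr : nat -> nat -> nat }.

Definition set_var (s : store) (x k : nat) : store :=
  Store (fun y => if y == x then k else var s y) (arr s).

Definition set_arr (s : store) (a i k : nat) : store :=
  Store (var s)
    (fun b j => if (b == a) && (j == i) then k else arr s b j).

(* Subtraction is truncated and division by zero returns zero. *)
Definition eval_op (o : binop) (x y : nat) : nat :=
  match o with
  | OpAdd => x + y
  | OpSub => x - y
  | OpMul => x * y
  | OpDiv => x %/ y
  | OpEq => x == y
  | OpLt => x < y
  end.

Fixpoint eval (s : store) (e : expr) : nat :=
  match e with
  | Const k => k
  | Var x => var s x
  | Get a i => arr s a (eval s i)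
  | Bin o e1 e2 => eval_op o (eval s e1) (eval s e2)
  end.

Fixpoint fits (W : nat) (s : store) (e : expr) : bool :=
  (eval s e <= W) &&
  match e with
  | Const _ | Var _ => true
  | Get _ i => fits W s i
  | Bin _ e1 e2 => fits W s e1 && fits W s e2
  end.

Fixpoint cost (e : expr) : nat :=
  match e with
  | Const _ | Var _ => 1
  | Get _ i => (cost i).+1
  | Bin _ e1 e2 => (cost e1 + cost e2).+1
  end.

(* exec W c s k s': from the store s, the program c halts in the store s'     *)
(* after k steps, and all values computed meanwhile are at most W.            *)
Inductive exec (W : nat) : cmd -> store -> nat -> store -> Prop :=
| ExecSkip s : exec W Skip s 1 s
| ExecAssign s x e : fits W s e ->
    exec W (Assign x e) s (cost e).+1 (set_var s x (eval s e))
| ExecPut s a i e : fits W s i -> fits W s e ->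
    exec W (Put a i e) s (cost i + cost e).+1
      (set_arr s a (eval s i) (eval s e))
| ExecSeq c1 c2 s1 s2 s3 k1 k2 :
    exec W c1 s1 k1 s2 -> exec W c2 s2 k2 s3 ->
    exec W (Seq c1 c2) s1 (k1 + k2).+1 s3
| ExecIf e c1 c2 s s' k : fits W s e ->
    exec W (if eval s e != 0 then c1 else c2) s k s' ->
    exec W (If e c1 c2) s (cost e + k).+1 s'
| ExecWhileEnd e c s : fits W s e -> eval s e = 0 ->
    exec W (While e c) s (cost e).+1 s
| ExecWhileStep e c s1 s2 s3 k1 k2 : fits W s1 e -> eval s1 e != 0 ->
    exec W c s1 k1 s2 -> exec W (While e c) s2 k2 s3 ->
    exec W (While e c) s1 (cost e + k1 + k2).+1 s3.

(* Variable 0 holds n and array 0 holds the adjacency matrix, row by row; all *)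
(* the rest of the memory is zero.                                            *)
Definition input (n : nat) (G : rel 'I_n) : store :=
  Store
    (fun x => if x == 0 then n else 0)
    (fun a k =>
       if a == 0 then
         [exists i : 'I_n, exists j : 'I_n, (k == i * n + j) && G i j] : nat
       else 0).

(* A link to the vertex i is coded by i.+1, and an absent child by 0. *)
Fixpoint links (n : nat) (left right : nat -> nat) (k : nat)
    (T : bintree 'I_n) : Prop :=
  if T is Node l v r then
    [/\ k = v.+1, links left right (left v) l & links left right (right v) r]
  else k = 0.

(* Variable 1 links to the root, and the entries v of arrays 1 and 2 to the   *)
(* left and the right child of v.                                             *)
Definition output (n : nat) (s : store) (T : bintree 'I_n) : Prop :=
  links (arr s 1) (arr s 2) (var s 1) T.

(* The words of a machine running on n vertices have O(log n) bits, i.e. they *)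
(* hold numbers up to a polynomial in n.                                      *)
Definition quadratic_time_algorithm
    (P : forall n, rel 'I_n -> bintree 'I_n -> Prop) : Prop :=
  exists (c : cmd) (C d : nat), forall (n : nat) (G : rel 'I_n),
    1 <= n -> tournament G ->
    exists (k : nat) (s : store) (T : bintree 'I_n),
      [/\ exec (d * n ^ d) c (input G) k s, k <= C * n ^ 2, output s T & P n G T].

Lemma exec_det (W : nat) (c : cmd) (s : store) (k1 k2 : nat) (s1 s2 : store) :
  exec W c s k1 s1 -> exec W c s k2 s2 -> k1 = k2 /\ s1 = s2.
Proof.
move=> E1; elim: E1 k2 s2 => {c s k1 s1};
  intros; match goal with E : exec _ _ _ ?k ?s |- _ = ?k /\ _ = ?s =>
    inversion E; subst; clear E end => //;
  try by match goal with E0 : eval ?s ?e = 0, E1 : is_true (eval ?s ?e != 0)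
    |- _ => rewrite E0 in E1 end.
all: repeat match goal with
  IH : (forall k s, exec _ ?c ?s0 k s -> _), E : exec _ ?c ?s0 _ _ |- _ =>
    have [? ?] := IH _ _ E; subst; clear E IH end; by [].
Qed.

(* Main.v *)
Require Import Defs.
From mathcomp Require Import all_boot all_order all_algebra.
From mathcomp Require Import all_classical all_reals all_analysis.
From mathcomp Require Import zify ring lra.

(** Every edge between a vertex of a shortcut tree and one of its descendants
    is a forward edge of the in-order path. What matters is the number
    e(L, R) of edges from the left to the right descendants of each vertex,
    compared to half of |L| |R|. Passing from forward edges to shortcuts costs
    at most one per vertex.

    Lower bound. Let l and r be the numbers of in-neighbours and
    out-neighbours of v. Call v a pivot if
    2 e(in, out) >= 'C(l, 2) + 'C(r, 2). Pivots exist ([pivot_exists]): summed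
    over all v, each side is twice the number of transitive triangles, because
    such a triangle has one middle vertex, one sink and one source. Taking
    pivots as roots recursively, the excess X of forward over backward edges
    satisfies X(l + r + 1) >= (l + r) / 2 + X(l) + X(r), and by convexity of
    x ln x it is at least 7 / 10 (n + 1) ln (n + 1) - n ([pivoted_forward]).
    This leaves enough room for the loss of n shortcuts and the factor 1 / 5,
    up to the constant 3122 ([excess_ge]).

    Algorithm. Whether v is a pivot can be read off from the outdegrees, so
    that a pivot of m vertices is found in time O(m ^ 2). Moreover
    e(in, out) <= l r shows that a pivot has
    (l + r) ^ 2 <= 6 l r + l + r. Hence the work m ^ 2 is at most
    3 (m ^ 2 - l ^ 2 - r ^ 2), and the sum of these differences over the whole
    recursion telescopes to n ^ 2 ([potential_step]). The program replaces the
    recursion by n rounds, in each of which the labels of the vertices tell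
    where in the unfinished tree they belong.

    Upper bound. In a uniformly random tournament, let 2 ^ k be about n. The
    descendants of a vertex v on the left and on the right are determined by
    the path from the root to v and by the edges that meet this path; so the
    edges between them are still random. By an exponential moment and a union
    bound over the paths of at most 2 k + 2 vertices, with positive probability
    every such pair of sets has 2 e(L, R) <= |L| |R| + (3 k + 8) (|L| + |R|)
    (unless |L| + |R| < 2 k, and then this holds for trivial reasons), and
    likewise no 2 k + 2 vertices have 2 k + 2 common descendants
    ([good_orientation]). Summing over the vertices of any tree, level by
    level, gives an excess of about 6 k ^ 2 n, that is, at most
    'C(n, 2) / 2 + 3 k ^ 2 n + O(k n) forward edges ([forward_region]). *)

Set Implicit Arguments.
Unset Strict Implicit.
Unset Printing Implicit Defensive.

Import Order.TTheory GRing.Theory Num.Theory.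

Local Open Scope nat_scope.

(** * Forward edges of an ordering *)

Fixpoint forward (V : Type) (G : rel V) (s : seq V) : nat :=
  if s is x :: s' then count (G x) s' + forward G s' else 0.

Definition cross (V : Type) (G : rel V) (A B : seq V) : nat :=
  \sum_(x <- A) count (G x) B.

Section Forward.
Variables (V : Type) (G : rel V).

Lemma forwardE (x0 : V) (s : seq V) :
  forward G s =
  \sum_(i < size s) \sum_(j < size s) ((i < j) && G (nth x0 s i) (nth x0 s j)).
Proof.
elim: s => [|x s IHs] /=; first by rewrite big_ord0.
rewrite big_ord_recl big_ord_recl /= add0n; congr (_ + _).
  by rewrite -sum1_count (big_nth x0) big_mkord big_mkcond.
rewrite IHs; apply: eq_bigr => i _.
by rewrite big_ord_recl /= add0n.
Qed.

Lemma path_shortcutsE (x0 : V) (s : seq V) :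
  path_shortcuts G s =
  \sum_(i < size s) \sum_(j < size s)
     ((i.+1 < j) && G (nth x0 s i) (nth x0 s j)).
Proof.
rewrite /path_shortcuts -sum1_card big_mkcond pair_big /=.
by apply: eq_bigr => -[i j] _ /=; rewrite !inE /= !(tnth_nth x0).
Qed.

Lemma path_shortcuts_le_forward (s : seq V) :
  path_shortcuts G s <= forward G s.
Proof.
case: s => [|x0 s]; first by rewrite (leq_trans (max_card _)) // card_prod card_ord.
rewrite (path_shortcutsE x0) (forwardE x0).
apply: leq_sum => i _; apply: leq_sum => j _.
by case: (ltnP i.+1 j) => // /ltnW ->.
Qed.

Lemma forward_le_path_shortcuts (s : seq V) :
  forward G s <= path_shortcuts G s + size s.
Proof.
case: s => [//|x0 s]; set s' := x0 :: s.
have sizeE : size s' = \sum_(i < size s') 1 by rewrite sum_nat_const card_ord muln1.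
rewrite (path_shortcutsE x0) (forwardE x0) [X in _ + X]sizeE -big_split /=.
apply: leq_sum => i _.
apply: (@leq_trans (\sum_(j < size s') (((i.+1 < j) && G (nth x0 s' i) (nth x0 s' j)) + (i.+1 == j :> nat)))).
  apply: leq_sum => j _; rewrite [i < j]leq_eqVlt.
  by case: (i.+1 == j :> nat); case: (i.+1 < j); case: (G _ _).
rewrite big_split leq_add2l.
case: (ltnP i.+1 (size s')) => [lt_i|le_i].
  rewrite (bigD1 (Ordinal lt_i)) //= eqxx big1 // => j.
  by rewrite -val_eqE /= eq_sym => /negbTE ->.
by rewrite big1 // => j _; case: eqP => // ij; have := ltn_ord j; lia.
Qed.

Lemma crossC (A B : seq V) :
  cross G A B = \sum_(y <- B) count (fun x => G x y) A.
Proof.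
rewrite /cross; under eq_bigr do rewrite -sum1_count big_mkcond /=.
by rewrite exchange_big; apply: eq_bigr => y _; rewrite -sum1_count [in RHS]big_mkcond.
Qed.

Lemma cross_catr (A B C : seq V) :
  cross G A (B ++ C) = cross G A B + cross G A C.
Proof. by rewrite /cross -big_split; apply: eq_bigr => x _; rewrite count_cat. Qed.

Lemma cross_le (A B : seq V) : cross G A B <= size A * size B.
Proof.
rewrite /cross; elim: A => [|x A IHA]; first by rewrite big_nil.
by rewrite big_cons mulSn leq_add ?count_size.
Qed.

Lemma forward_cat (A B : seq V) :
  forward G (A ++ B) = forward G A + forward G B + cross G A B.
Proof.
elim: A => [|x A IHA]; first by rewrite /cross big_nil addn0.
rewrite /= IHA /cross big_cons count_cat; lia.
Qed.

Lemma forward_le_sq (s : seq V) : 2 * forward G s <= size s * (size s).-1.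
Proof.
elim: s => //= x s IHs; have := count_size (G x) s.
by case: (size s) IHs => [|m] /=; nia.
Qed.

Lemma forward_node (l r : bintree V) (v : V) :
  shortcut_tree G (Node l v r) ->
  forward G (inorder (Node l v r)) =
    forward G (inorder l) + forward G (inorder r)
    + size (inorder l) + size (inorder r) + cross G (inorder l) (inorder r).
Proof.
case/and4P => allL allR _ _; rewrite /= forward_cat /= -cat1s cross_catr.
rewrite (crossC _ [:: v]) big_seq1.
by move: allL allR; rewrite !all_count => /eqP -> /eqP ->; lia.
Qed.

End Forward.

Section PermCross.
Variables (V : eqType) (G : rel V).

Lemma perm_cross (A A' B B' : seq V) :
  perm_eq A A' -> perm_eq B B' -> cross G A B = cross G A' B'.
Proof.
move=> pA pB; rewrite /cross (perm_big _ pA) /=.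
by apply: eq_bigr => x _; apply/permP.
Qed.

End PermCross.

(** * Pivots of a tournament *)

Section Pivot.
Variables (V : eqType) (G : rel V).
Hypotheses (irrG : irreflexive G) (totG : forall u v, u != v -> G u v (+) G v u).
Implicit Types (s : seq V) (u v : V).

Definition inn s v := [seq u <- s | G u v].
Definition outn s v := [seq u <- s | G v u].

Lemma perm_nbrs s v : uniq s -> v \in s -> perm_eq s (inn s v ++ v :: outn s v).
Proof.
move=> uniq_s vs; rewrite -cat1s perm_sym perm_catCA cat1s.
rewrite (perm_trans _ (_ : perm_eq (v :: rem v s) s)) //; last first.
  by rewrite perm_sym perm_to_rem.
rewrite perm_cons rem_filter // perm_sym -(perm_filterC (G^~ v)).
rewrite /inn /outn -!filter_predI.
have -> : [seq x <- s | predI (G^~ v) (predC1 v) x] = [seq u <- s | G u v].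
  by apply: eq_filter => u /=; case: eqP => [->|]; rewrite ?irrG ?andbT.
have -> // : [seq x <- s | predI (predC (G^~ v)) (predC1 v) x] = [seq u <- s | G v u].
apply: eq_filter => u /=; case: (eqVneq u v) => [->|/totG]; rewrite ?irrG ?andbF //.
by rewrite andbT; case: (G u v); case: (G v u).
Qed.

Lemma size_nbrs s v : uniq s -> v \in s ->
  size s = (size (inn s v) + size (outn s v)).+1.
Proof. by move=> uniq_s vs; rewrite (perm_size (perm_nbrs uniq_s vs)) size_cat /= addnS. Qed.

Lemma cross_self s : uniq s -> 2 * cross G s s + size s = size s * size s.
Proof.
move=> uniq_s; rewrite mul2n -addnn {1}crossC /cross -big_split /=.
have -> : size s * size s = \sum_(v <- s) size s by rewrite big_const_seq count_predT iter_addn_0.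
rewrite -[X in _ + X]sum1_size -big_split big_seq [RHS]big_seq /=.
by apply: eq_bigr => v vs; rewrite [in RHS](size_nbrs uniq_s vs) !size_filter addn1.
Qed.

(** With l in-neighbours and r out-neighbours of v, this is the inequality
    2 e(in, out) >= 'C(l, 2) + 'C(r, 2), rewritten by means of the outdegrees
    within s. The point of this form is its price: once all outdegrees are
    known it is tested in linear time, whereas counting e(in, out) directly
    for every candidate v would be cubic. *)
Definition pivot_test s v :=
  3 * size (inn s v) ^ 2 + size (inn s v) + size (outn s v) ^ 2
  <= 4 * (\sum_(u <- inn s v) count (G u) s) + size (outn s v).

(** The in-neighbours of v have outdegree 1 (towards v) plus what they send to
    each other, 'C(l, 2) in all, plus e(in, out). *)
Lemma pivot_testE s v : uniq s -> v \in s ->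
  pivot_test s v =
  (size (inn s v) ^ 2 + size (outn s v) ^ 2 <=
   4 * cross G (inn s v) (outn s v) + size (inn s v) + size (outn s v)).
Proof.
move=> uniq_s vs; rewrite /pivot_test.
have -> : \sum_(u <- inn s v) count (G u) s = cross G (inn s v) s by [].
rewrite (perm_cross G (perm_refl _) (perm_nbrs uniq_s vs)) cross_catr -cat1s cross_catr.
have := cross_self (filter_uniq (G^~ v) uniq_s); rewrite -/(inn s v).
have -> : cross G (inn s v) [:: v] = size (inn s v).
  rewrite crossC big_seq1; apply/eqP; rewrite -all_count; exact: filter_all.
by rewrite -!mulnn; lia.
Qed.

(** Summed over all v, the two sides of the test agree. In terms of triangles:
    e(in, out) counts the transitive triangles whose middle vertex is v, and
    'C(l, 2) + 'C(r, 2) counts those, of all triangles, in which v is a sink or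
    a source; a transitive triangle has one middle, one sink and one source,
    and a cyclic one has none. With outdegrees d, the computation reduces to
    the equality of the sums of l and d, and of l ^ 2 and d ^ 2. *)
Lemma pivot_exists s : uniq s -> s != [::] -> exists2 v, v \in s & pivot_test s v.
Proof.
move=> uniq_s s_n0; apply/hasP; apply: contraT; rewrite -all_predC => /allP noP.
pose d u := count (G u) s; pose l u := size (inn s u).
have dE u : size (outn s u) = d u by rewrite size_filter.
have suml : \sum_(v <- s) l v = \sum_(v <- s) d v.
  rewrite -[RHS]/(cross G s s) crossC.
  by apply: eq_bigr => v _; rewrite /l size_filter.
have sumd2 : \sum_(v <- s) (\sum_(u <- inn s v) d u) = \sum_(u <- s) d u ^ 2.
  under eq_bigr do rewrite big_filter big_mkcond /=.
  rewrite exchange_big; apply: eq_bigr => u _; rewrite -big_mkcond /=.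
  by rewrite big_const_seq iter_addn_0 -mulnn.
have ldE v : v \in s -> l v + d v = (size s).-1.
  by move=> vs; rewrite -dE (size_nbrs uniq_s vs).
have suml2 : \sum_(v <- s) l v ^ 2 = \sum_(v <- s) d v ^ 2.
  apply: (@addIn ((size s).-1 * \sum_(v <- s) d v)).
  rewrite -{2}suml !big_distrr -!big_split big_seq [RHS]big_seq /=.
  by apply: eq_bigr => v /ldE <-; rewrite -!mulnn; ring.
have : \sum_(v <- s) (4 * (\sum_(u <- inn s v) d u) + d v + 1)
     <= \sum_(v <- s) (3 * l v ^ 2 + l v + d v ^ 2).
  rewrite big_seq [leqRHS]big_seq; apply: leq_sum => v vs.
  by have := noP v vs; rewrite /= /pivot_test -ltnNge dE addn1.
have := s_n0; rewrite -size_eq0.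
rewrite !big_split /= !big1_eq sumd2 suml2 suml sum1_size.
by lia.
Qed.
End Pivot.

(** * Counting shortcuts of a tree of pivots *)

(** Every root of a subtree satisfies the pivot condition
    2 e(left, right) >= 'C(l, 2) + 'C(r, 2), doubled. *)
Fixpoint pivoted (V : Type) (G : rel V) (T : bintree V) : bool :=
  if T is Node l v r then
    [&& size (inorder l) ^ 2 + size (inorder r) ^ 2 <=
        4 * cross G (inorder l) (inorder r) + size (inorder l) + size (inorder r),
        pivoted G l & pivoted G r]
  else true.

Section LowerBound.
Variable R : realType.
Local Open Scope ring_scope.

(** The convex function x ln x lies above its tangent at y. *)
Lemma ln_tangent (x y : R) : 0 < x -> 0 < y -> x * ln y + x - y <= x * ln x.
Proof.
move=> x0 y0; have : ln (y / x) <= y / x - 1.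
  by rewrite -[y / x in X in X <= _](subrKC 1) le_ln1Dx // ltrBrDl subrr divr_gt0.
rewrite ln_div // -(ler_pM2l x0) !mulrBr mulrCA divff ?gt_eqF // !mulr1; lra.
Qed.

(** As 1 + 5 / 112 <= e ^ (5 / 112), it suffices that (117 / 112) ^ 16 >= 2. *)
Lemma ln2_le : ln 2 <= 5 / 7 :> R.
Proof.
rewrite -ler_expR lnK ?posrE //.
have -> : 5 / 7 = 16%:R * (5 / 112) :> R by lra.
rewrite expRM_natl; set x := expR _.
have x_ge : 117 / 112 <= x by apply: le_trans (expR_ge1Dx _); lra.
have x2 : 1091 / 1000 <= x ^+ 2 by rewrite expr2; nra.
have x4 : 119 / 100 <= x ^+ 4 by rewrite (exprM x 2 2) expr2; nra.
have x8 : 1416 / 1000 <= x ^+ 8 by rewrite (exprM x 4 2) expr2; nra.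
have -> : x ^+ 16 = x ^+ 8 * x ^+ 8 by rewrite -exprD.
by nra.
Qed.

(** From 5 / 6 <= e ^ (- 1 / 6) it follows that e <= (6 / 5) ^ 6 < 3. *)
Lemma ln3_ge1 : 1 <= ln 3 :> R.
Proof.
rewrite -ler_expR lnK ?posrE //.
have x_ge : 5 / 6 <= expR (- (1 / 6)) :> R by apply: le_trans (expR_ge1Dx _); lra.
have : expR 1 * expR (- (1 / 6)) ^+ 6 = 1 :> R.
  by rewrite -expRM_natl -expRD [X in expR X](_ : _ = 0) ?expR0 //; lra.
have : (5 / 6) ^+ 6 <= expR (- (1 / 6)) ^+ 6 :> R by rewrite lerXn2r ?nnegrE ?expR_ge0 //; lra.
have := expR_gt0 (1 : R).
set x := expR _ ^+ 6; set y := expR 1 => y0.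
nra.
Qed.

(** A lower bound for the excess of forward over backward edges of a tree of
    pivots with m vertices. The perfectly balanced trees are the worst case and
    have N log2 N / 2 - N + 1 with N = m + 1; here 1 / (2 ln 2) is rounded down
    to 7 / 10, which suffices as ln 2 <= 5 / 7. *)
Definition excess (m : nat) : R := 7 / 10 * (m.+1%:R * ln m.+1%:R) - m%:R.

(** The recursion of the excess at a root with l + r descendants: convexity of
    x ln x, through its tangent at the mean, shows that the balanced split is
    the worst one. *)
Lemma excess_split (l r : nat) :
  excess (l + r).+1 <= (l + r)%:R / 2 + excess l + excess r.
Proof.
rewrite /excess; set M : R := (l + r).+2%:R / 2.
have M0 : 0 < M by rewrite divr_gt0.
have l0 : 0 < l.+1%:R :> R by [].
have r0 : 0 < r.+1%:R :> R by [].
have := ln_tangent l0 M0; have := ln_tangent r0 M0.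
have -> : ln M = ln (l + r).+2%:R - ln 2 by rewrite ln_div ?posrE.
have : (l + r).+2%:R = l.+1%:R + r.+1%:R :> R by rewrite -natrD addnS addSn.
have : (l + r)%:R = l%:R + r%:R :> R by rewrite natrD.
rewrite /M -(natr1 l) -(natr1 r) -(natr1 (l + r)) => E1 E2; rewrite E2 E1 in l0 r0 *.
have := ln2_le.
have := ler0n R l; have := ler0n R r.
set a := ln (_ + _); set b := ln _; set c := ln (r%:R + 1); set d := ln (l%:R + 1).
move=> r0' l0' a57.
have : (l%:R + r%:R + 2) * a <= (l%:R + r%:R + 2) * (5 / 7) by apply: ler_wpM2l; lra.
by lra.
Qed.

(** At a root, the l + r edges to descendants are forward, and the pivot
    condition makes e(l, r) - e(r, l) at least ((l - r) ^ 2 - (l + r)) / 2; so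
    the root contributes at least (l + r) / 2 to the excess. *)
Lemma pivoted_forward (V : Type) (G : rel V) (T : bintree V) (m := size (inorder T)) :
  shortcut_tree G T -> pivoted G T ->
  m%:R * (m%:R - 1) + 2 * excess m <= 4 * (forward G (inorder T))%:R.
Proof.
rewrite {}/m; elim: T => [|l IHl v r IHr] /=.
  by move=> _ _; rewrite /excess ln1 !mulr0 !mul0r subr0 mulr0 addr0.
move=> /[dup] /and4P[_ _ /IHl{}IHl /IHr{}IHr] stT /and3P[piv /IHl{}IHl /IHr{}IHr].
rewrite (forward_node stT) size_cat /= addnS.
have := excess_split (size (inorder l)) (size (inorder r)).
move: piv; set cr := cross _ _ _.
have -> : (4 * cr = cr + cr + cr + cr)%N by lia.
rewrite -(ler_nat R) !natrD !natrX.
move: IHl IHr; rewrite -(natr1 (_ + _)) !natrD.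
set a := excess _; set b := excess _; set c := excess _.
set x := (size (inorder l))%:R; set y := (size (inorder r))%:R.
have := sqr_ge0 (x - y); lra.
Qed.

(** The coefficient of n ln n on the right is 7 / 20. The surplus
    3 / 20 n ln n over the required n ln n / 5 has to pay for the linear terms,
    up to the constant 3122: the tangent of x ln x at 3 ^ 9, with ln 3 >= 1,
    gives x ln x >= 10 x - 3 ^ 9, and 3 / 20 * 3 ^ 9 < 3122. *)
Lemma excess_ge (n : nat) :
  2^-1 * 'C(n, 2)%:R + n%:R * ln n%:R / 5 - 3122 <=
  (n%:R * (n%:R - 1) + 2 * excess n) / 4 - n%:R :> R.
Proof.
have -> : 'C(n, 2)%:R = n%:R * (n%:R - 1) / 2 :> R.
  have := mul_bin_diag n 1; rewrite bin1 => /(congr1 (fun k => k%:R : R)).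
  case: n => [|n]; first by rewrite bin0n /= !mul0r.
  by rewrite !natrM /= -(natr1 n); lra.
rewrite /excess -(natr1 n); have n0 := ler0n R n.
have [-> |n_gt0] := posnP n; first by rewrite ln0 // !add0r ln1; lra.
have N0 : 0 < n%:R + 1 :> R by lra.
have y0 : 0 < 3 ^+ 9 :> R by rewrite exprn_gt0.
have := ln_tangent N0 y0; rewrite lnXn // -[ln 3 *+ 9]mulr_natl.
have : n%:R * ln n%:R <= (n%:R + 1) * ln (n%:R + 1) :> R.
  by rewrite ler_pM ?ln_ge0 ?ler1n // ?ler_ln ?posrE ?ltr0n //; lra.
have := ln3_ge1.
have -> : 3 ^+ 9 = 19683 :> R by rewrite !exprS; lra.
set a := ln 3; set b := n%:R * ln n%:R; set c := ln (n%:R + 1) => a1 bc.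
have : (n%:R + 1) * 9 <= (n%:R + 1) * (9 * a) by apply: ler_wpM2l; lra.
by lra.
Qed.

Lemma pivoted_shortcuts (V : Type) (G : rel V) (T : bintree V)
    (n := size (inorder T)) :
  shortcut_tree G T -> pivoted G T ->
  2^-1 * 'C(n, 2)%:R + n%:R * ln n%:R / 5 - 3122 <= (shortcuts G T)%:R :> R.
Proof.
move=> stT pivT; apply: le_trans (excess_ge _) _.
have := pivoted_forward stT pivT.
have := forward_le_path_shortcuts G (inorder T).
rewrite -(ler_nat R) natrD -/(shortcuts G T) -/n; lra.
Qed.

End LowerBound.

Lemma pivoted_tree_exists (V : eqType) (G : rel V) (s : seq V) :
  irreflexive G -> (forall u v, u != v -> G u v (+) G v u) -> uniq s ->
  exists T, [/\ perm_eq (inorder T) s, shortcut_tree G T & pivoted G T].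
Proof.
move=> irrG totG; have [m] := ubnP (size s).
elim: m s => // m IHm s sz_s uniq_s.
have [-> |s_n0] := eqVneq s [::]; first by exists Leaf.
have [v vs piv] := pivot_exists irrG totG uniq_s s_n0.
have sz := size_nbrs irrG totG uniq_s vs.
have [|l [pl tl bl]] := IHm (inn G s v) _ (filter_uniq _ uniq_s); first by lia.
have [|r [pr tr br]] := IHm (outn G s v) _ (filter_uniq _ uniq_s); first by lia.
exists (Node l v r); split => /=.
- rewrite (permPr (perm_nbrs irrG totG uniq_s vs)).
  by apply: perm_cat => //; rewrite perm_cons.
- by rewrite tl tr (perm_all _ pl) (perm_all _ pr) !filter_all.
by rewrite bl br (perm_size pl) (perm_size pr) (perm_cross G pl pr) -(pivot_testE irrG totG) // piv.
Qed.

Lemma t_ge (R : realType) (n : nat) : 1 <= n ->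
  (2^-1 * 'C(n, 2)%:R + n%:R * ln n%:R / 5 - 3122 <= (t n)%:R :> R)%R.
Proof.
move=> n_gt0; rewrite /t; case: ex_maxnP => k _ k_max.
rewrite leNgt; apply/negP => lt_k.
suff /asboolP /k_max : always_shortcuts n k.+1 by rewrite ltnn.
move=> V G cardV [irrG totG].
have [T [pT tT bT]] := pivoted_tree_exists irrG totG (enum_uniq V).
exists T; first by apply/andP.
rewrite -(ltr_nat R); apply: lt_le_trans lt_k _.
by have := pivoted_shortcuts R tT bT; rewrite (perm_size pT) -cardE cardV.
Qed.

(** * Random tournaments *)

Section Random.
Variable n : nat.
Notation V := 'I_n.
Notation coins := {ffun V * V -> bool}.
Implicit Types (f g : coins) (C : {set V}) (q : seq (V * bool)).

(** The tournament given by tossing a coin for every pair; only the coins (u, v)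
    with u < v are looked at. *)
Definition orient f : rel V :=
  fun u v => if u < v then f (u, v) else (v < u) && ~~ f (v, u).

Lemma orient_tournament f : tournament (orient f).
Proof.
split=> [u|u v]; rewrite /orient ?ltnn // -val_eqE /=.
by case: ltngtP => //= _ _; case: (f _).
Qed.

Definition touch C (e : V * V) := (e.1 \in C) || (e.2 \in C).

(** What f reveals about the edges that meet C, the other coins being set to
    false. *)
Definition expose C f : coins := [ffun e => touch C e && f e].

Lemma orient_expose C f a u :
  a \in C -> orient (expose C f) a u = orient f a u /\ orient (expose C f) u a = orient f u a.
Proof. by move=> aC; rewrite /orient !ffunE /touch /= aC orbT. Qed.

(** The vertex sets A and B and the weights w may depend on the coins of the
    edges that meet C; given those, the edges between A and B are independent
    and each has a weight of mean 1. *)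
Section Weight.
Variables (R : realFieldType) (C : {set V}) (A B : coins -> {set V}).
Variable w : coins -> V -> bool -> R.
Hypothesis A_C : forall f x, x \in A f -> x \notin C.
Hypothesis B_C : forall f x, x \in B f -> x \notin C.
Hypothesis AB : forall f, [disjoint A f & B f].
Hypothesis A_restr : forall f, A (expose C f) = A f.
Hypothesis B_restr : forall f, B (expose C f) = B f.
Hypothesis w_restr : forall f, w (expose C f) = w f.
Hypothesis w_sum : forall f x, (w f x true + w f x false = 2)%R.

Definition weight f : R := (\prod_(x in A f) \prod_(y in B f) w f x (orient f x y))%R.

Local Open Scope ring_scope.

Let phi g (e : V * V) (b : bool) : R :=
  (if [&& (e.1 < e.2)%N, e.1 \in A g & e.2 \in B g] then w g e.1 b else 1) *
  (if [&& (e.1 < e.2)%N, e.1 \in B g & e.2 \in A g] then w g e.2 (~~ b) else 1).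

(** The factor of a coin (x, y) with x < y is the weight of the edge between x
    and y, in whichever direction it crosses from A to B. *)
Lemma weight_coins f g : A f = A g -> B f = B g -> w f = w g ->
  weight f = \prod_e phi g e (f e).
Proof.
rewrite /weight => -> -> ->.
rewrite (eq_bigr (fun p : V * V => phi g (p.1, p.2) (f (p.1, p.2)))); last by case.
rewrite -(pair_bigA _ (fun x y => phi g (x, y) (f (x, y)))) /=.
under [RHS]eq_bigr do rewrite big_split.
rewrite big_split /= [X in _ * X]exchange_big -big_split big_mkcond /=.
apply: eq_bigr => x _; rewrite -big_split /=.
case: ifP => [xA|xNA]; last first.
  by rewrite big1 // => y _; rewrite !andbF mulr1.
rewrite big_mkcond; apply: eq_bigr => y _ /=.
case: ifP => [yB|yNB]; last by rewrite !andbF mulr1.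
have : x != y by apply: contraTneq xA => ->; rewrite (disjointFl (AB g) yB).
by rewrite /orient -val_eqE /= !andbT; case: ltngtP => //=; rewrite ?mulr1 ?mul1r.
Qed.

(** The weight has mean 1: conditioned on the exposed coins g, the other coins
    range over a product family, and the sum of products is a product of
    sums. *)
Lemma sum_weight : \sum_f weight f = #|{: coins}|%:R.
Proof.
rewrite -sum1_card natr_sum.
rewrite (partition_big (expose C) xpredT) // [RHS](partition_big (expose C) xpredT) //=.
apply: eq_bigr => g _.
have [restr_g|restr_g] := eqVneq (expose C g) g; last first.
  rewrite !big1 // => f /eqP fg; case/eqP: restr_g; rewrite -fg.
  - by apply/ffunP => e; rewrite !ffunE andbA andbb.
  - by apply/ffunP => e; rewrite !ffunE andbA andbb.
pose Q (e : V * V) : pred bool := if touch C e then pred1 (g e) else predT.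
have famE f : (expose C f == g) = (f \in family Q).
  apply/eqP/familyP => [fg e|fQ].
    by rewrite /Q; case: ifP => // te; rewrite inE -fg ffunE te.
  apply/ffunP => e; rewrite ffunE; have := fQ e; rewrite /Q; case: ifP => te.
    by rewrite inE => /eqP ->.
  by move=> _; rewrite -restr_g ffunE te.
rewrite (eq_bigl _ _ famE) [RHS](eq_bigl _ _ famE).
rewrite (eq_bigr (fun f => \prod_e phi g e (f e))); last first.
  move=> f; rewrite -famE => /eqP fg.
  by apply: weight_coins; rewrite -fg ?A_restr ?B_restr ?w_restr.
rewrite [RHS](eq_bigr (fun f : coins => \prod_(e : V * V) 1)); last by move=> f _; rewrite big1_eq.
rewrite -bigA_distr_big_dep -(bigA_distr_big_dep Q (fun _ _ => 1)) /=.
apply: eq_bigr => -[x y] _; rewrite /Q /phi /touch /=; case: ifP => te.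
  apply: eq_bigr => b _.
  rewrite !ifN ?mulr1 //; apply/negP => /and3P[_ h1 h2]; move: te.
    by rewrite (negbTE (B_C h1)) (negbTE (A_C h2)).
  by rewrite (negbTE (A_C h1)) (negbTE (B_C h2)).
rewrite !big_bool /=.
case: (boolP [&& _, x \in A g & _]) => [/and3P[_ xA yB]|_].
  by rewrite (disjointFr (AB g) xA) !andbF /= !mulr1 w_sum.
by case: ifP => _; rewrite !mul1r // addrC w_sum.
Qed.

Hypothesis w_ge0 : forall f x b, 0 <= w f x b.

Lemma markov_weight (c : R) (bad : pred coins) :
  (forall f, bad f -> c <= weight f) -> c * #|bad|%:R <= #|{: coins}|%:R.
Proof.
move=> le_c; rewrite -sum_weight -sum1_card natr_sum mulr_sumr.
rewrite [leRHS](bigID bad) /= -[leLHS]addr0 lerD //.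
  by apply: ler_sum => f; rewrite mulr1 => /le_c.
by apply: sumr_ge0 => f _; do 2!apply: prodr_ge0 => ? _.
Qed.

End Weight.

(** Each of the bad events has probability at most 1 / c, so all together have
    probability at most 1 / 4. *)
Lemma union_bound (R : realFieldType) (P : finType) (bad : P -> pred coins) (c : R) :
  (4 * #|P|%:R <= c -> (forall p, c * #|bad p|%:R <= #|{: coins}|%:R) ->
  4 * #|[pred f | [exists p, bad p f]]|%:R <= #|{: coins}|%:R :> R)%R.
Proof.
move=> le_c le_bad.
have bound : (#|[pred f | [exists p, bad p f]]|%:R <= \sum_p #|bad p|%:R :> R)%R.
  rewrite -natr_sum ler_nat -sum1_card; under [leqRHS]eq_bigr do rewrite -sum1_card big_mkcond.
  rewrite exchange_big big_mkcond; apply: leq_sum => f _ /=.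
  case: ifP => // /existsP[p bpf]; rewrite (bigD1 p) //=.
  by rewrite (_ : f \in bad p).
have [P0 | P_gt0] := posnP #|P|.
  move: bound; rewrite big_pred0; last first.
    by move=> p; have := max_card (pred1 p); rewrite card1 P0.
  by have := ler0n R #|{: coins}|; lra.
have c_gt0 : (0 < c)%R by apply: lt_le_trans le_c; rewrite mulr_gt0 ?ltr0n.
rewrite -(ler_pM2l c_gt0) mulrCA.
apply: (@le_trans _ _ (4 * (\sum_(p : P) #|{: coins}|%:R)))%R.
  rewrite ler_pM2l // (le_trans (ler_wpM2l (ltW c_gt0) bound)) // mulr_sumr.
  exact: ler_sum.
by rewrite sumr_const -[X in (4 * X)%R]mulr_natl mulrA ler_wpM2r.
Qed.

End Random.

(** * Tournaments without good trees *)

(** A path from the root of a tree is recorded as the list of its vertices, each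
    with the side on which the path leaves it (true for the right). In a
    spanning shortcut tree the vertices below this path are exactly the
    vertices that have the prescribed adjacencies to the path, so that they
    are determined by the path and the tournament. *)
Definition region (V : finType) (G : rel V) (q : seq (V * bool)) : {set V} :=
  [set u | all (fun av => if av.2 then G av.1 u else G u av.1) q].

Lemma region_path (V : finType) (G : rel V) q u : irreflexive G ->
  u \in region G q -> u \notin map fst q.
Proof.
move=> irrG; rewrite inE => /allP uq; apply/negP => /mapP[[a b] /uq /= Hu ua].
by move: Hu; rewrite ua irrG if_same.
Qed.

Lemma tournament_asym (V : finType) (G : rel V) u v :
  tournament G -> G u v -> G v u = false.
Proof.
case=> irrG totG uv; have : u != v by apply: contraTneq uv => ->; rewrite irrG.
by move/totG; rewrite uv; case: (G v u).
Qed.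

Lemma bin2_node a b : 'C((a + b).+1, 2) = 'C(a, 2) + 'C(b, 2) + a * b + a + b.
Proof.
elim: b => [|b IHb]; first by rewrite addn0 binS bin1 bin0n; lia.
by rewrite addnS binS bin1 IHb [in RHS]binS bin1; lia.
Qed.

Section UpperBound.
Variable n : nat.
Notation V := 'I_n.
Notation coins := {ffun V * V -> bool}.
Implicit Types (f g : coins) (q : seq (V * bool)).

Lemma region_expose (C : {set V}) f q : {subset map fst q <= C} ->
  region (orient (expose C f)) q = region (orient f) q.
Proof.
move=> qC; apply/setP => u; rewrite !inE; apply: eq_in_all => -[a b] abq /=.
by have aC := qC a (map_f fst abq); have [-> ->] := orient_expose f u aC.
Qed.

Section Probability.
Variable R : realType.
Local Open Scope ring_scope.

Lemma expR_le_up (h : R) : 0 <= h -> expR (h - h ^+ 2) <= 1 + h.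
Proof.
move=> h0; rewrite -(ler_pM2r (expR_gt0 (- (h - h ^+ 2)))) -expRD addrN expR0.
have : (1 + h) * (1 - (h - h ^+ 2)) <= (1 + h) * expR (- (h - h ^+ 2)).
  by rewrite ler_wpM2l ?expR_ge1Dx //; lra.
have : 0 <= h ^+ 3 by rewrite exprn_ge0.
lra.
Qed.

Lemma expR_le_down (h : R) : 0 <= h <= 1 / 2 -> expR (- (h + 2 * h ^+ 2)) <= 1 - h.
Proof.
move=> /andP[h0 h12].
rewrite -(ler_pM2r (expR_gt0 (h + 2 * h ^+ 2))) -expRD addNr expR0.
have : (1 - h) * (1 + (h + 2 * h ^+ 2)) <= (1 - h) * expR (h + 2 * h ^+ 2).
  by rewrite ler_wpM2l ?expR_ge1Dx //; lra.
have : 0 <= h ^+ 2 * (1 / 2 - h) by rewrite mulr_ge0 ?sqr_ge0 //; lra.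
lra.
Qed.

Lemma exp2_le_expR (x : nat) : 2 ^+ x <= expR x%:R :> R.
Proof.
rewrite -[x%:R]mulr1 expRM_natl lerXn2r ?nnegrE ?expR_ge0 //.
by have := expR_ge1Dx (1 : R); lra.
Qed.

(** The weight (1 + h) per edge and (1 - h) per missing edge from left to right
    has mean 1. With h = k / (l + r), a surplus of (3 k + 8) (l + r) edges makes
    its logarithm at least (3 k + 8) k - 2 h ^ 2 l r >= 5 / 2 k ^ 2 + 8 k, which
    exceeds the logarithm of the number of paths of length 2 k + 2. *)
Lemma bias_weight (k l r e : nat) (h := k%:R / (l + r)%:R : R) :
  (0 < l + r)%N -> (2 * k <= l + r)%N -> (e <= l * r)%N ->
  (l * r + (3 * k + 8) * (l + r) < 2 * e)%N ->
  (5 <= k)%N ->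
  4 * 2 ^+ ((k.+1) * (2 * k + 2) + k) <= (1 + h) ^+ e * (1 - h) ^+ (l * r - e).
Proof.
move=> m_gt0 k_le le_e lt_e k5.
have m0 : 0 < (l + r)%:R :> R by rewrite ltr0n.
have hm : h * (l + r)%:R = k%:R by rewrite /h divfK ?gt_eqF.
have h0 : 0 <= h by rewrite divr_ge0.
have h12 : h <= 1 / 2.
  by rewrite /h ler_pdivrMr // mulrAC ler_pdivlMr // mul1r -natrM mulnC ler_nat.
have b1 : expR ((h - h ^+ 2) * e%:R) <= (1 + h) ^+ e.
  by rewrite mulrC expRM_natl lerXn2r ?nnegrE ?expR_ge0 ?expR_le_up //; lra.
have b2 : expR (- (h + 2 * h ^+ 2) * (l * r - e)%:R) <= (1 - h) ^+ (l * r - e).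
  by rewrite mulrC expRM_natl lerXn2r ?nnegrE ?expR_ge0 ?expR_le_down ?h0 //; lra.
apply: le_trans (ler_pM (expR_ge0 _) (expR_ge0 _) b1 b2).
rewrite -expRD -[4]/((2 * 2)%:R) natrM -expr2 -exprD.
apply: le_trans (exp2_le_expR _) _; rewrite ler_expR natrB //.
have : (l * r + (3 * k + 8) * (l + r))%:R <= (2 * e)%:R :> R by rewrite ler_nat ltnW.
have : e%:R <= (l * r)%:R :> R by rewrite ler_nat.
have : (4 * (l * r))%:R <= ((l + r) * (l + r))%:R :> R.
  by rewrite ler_nat mulnn; case: (nat_AGM2 l r).
rewrite -[k.+1]addn1 !(natrM, natrD).
have : 5 <= k%:R :> R by rewrite ler_nat.
move: m0 hm; rewrite natrD.
set K := k%:R; set m := l%:R + r%:R; set N := l%:R * r%:R; set E := e%:R.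
move=> m0 hm K5 H1 H2 H3.
have hh : h ^+ 2 * (m * m) = K ^+ 2 by rewrite -expr2 -exprMn hm.
have P1 : h ^+ 2 * (4 * N) <= h ^+ 2 * (m * m) by rewrite ler_wpM2l ?sqr_ge0.
have P2 : h * (N + (3 * K + 8) * m) <= h * (2 * E) by rewrite ler_wpM2l.
have P3 : 0 <= h ^+ 2 * E by rewrite mulr_ge0 ?sqr_ge0 ?ler0n.
have P4 : h * ((3 * K + 8) * m) = (3 * K + 8) * K by rewrite -hm; ring.
nra.
Qed.

End Probability.

Variable k : nat.
Hypotheses (k_ge5 : 5 <= k) (n_lt : n < 2 ^ k).
(* The number of levels of a tree that are examined, about 2 log2 n. *)
Let D := 2 * k + 2.

Let D_gt0 : 0 < D. Proof. by rewrite /D addn2. Qed.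

(** The pair (q, v) stands for a vertex v at the end of the path q. The event is
    that its left and right descendants have an e(left, right) that exceeds
    half of its maximum by far. Fewer than 2 k descendants are left out: their
    e(left, right) is small anyway, and h <= 1 / 2 in the weight argument
    depends on it. *)
Definition skewed f q v :=
  let L := region (orient f) ((v, false) :: q) in
  let R := region (orient f) ((v, true) :: q) in
  [&& 0 < #|L| + #|R|, 2 * k <= #|L| + #|R| &
  #|L| * #|R| + (3 * k + 8) * (#|L| + #|R|) < 2 * cross (orient f) (enum L) (enum R)].

Lemma prod_bias (R : realType) (G : rel V) (L M : {set V}) (a b : R) :
  (\prod_(x in L) \prod_(y in M) (if G x y then a else b) =
   a ^+ cross G (enum L) (enum M) *
   b ^+ (#|L| * #|M| - cross G (enum L) (enum M)))%R.
Proof.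
pose c x := count (G x) (enum M).
have inner x : (\prod_(y in M) (if G x y then a else b) = a ^+ c x * b ^+ (#|M| - c x))%R.
  rewrite -big_enum /c cardE /=; elim: (enum M) => [|y s IHs]; first by rewrite big_nil !expr0 mulr1.
  rewrite big_cons IHs /=; case: (G x y); first by rewrite add1n exprS mulrA subSS.
  by rewrite add0n subSn ?count_size // exprS mulrCA.
rewrite (eq_bigr _ (fun x _ => inner x)) big_split /=.
rewrite -!big_enum /= !prodrXr /cross; congr (_ * b ^+ _)%R.
have c_le x : c x <= #|M| by rewrite cardE count_size.
rewrite sumnB //.
by rewrite big_const_seq count_predT iter_addn_0 -cardE mulnC.
Qed.

(** Paths of at most D vertices are padded to tuples by None. The sets of left
    and right descendants depend on the edges at the path only, hence their
    crossing edges are still random. *)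
Lemma card_skewed (R : realType) :
  (4 * #|[pred f | [exists p : D.-tuple (option (V * bool)) * V,
             skewed f (pmap id p.1) p.2]]|%:R <= #|{: coins}|%:R :> R)%R.
Proof.
apply: (union_bound (c := (4 * 2 ^+ ((k.+1) * (2 * k + 2) + k))%R)).
  rewrite ler_pM2l // -natrX ler_nat card_prod card_tuple card_option card_prod.
  rewrite card_ord card_bool expnD leq_mul ?(ltnW n_lt) // expnM leq_exp2r //.
  by rewrite expnS; lia.
move=> [p v] /=; set q := pmap id p.
pose C : {set V} := [set x in v :: map fst q].
pose A f := region (orient f) ((v, false) :: q).
pose B f := region (orient f) ((v, true) :: q).
pose h f : R := (if (2 * k <= #|A f| + #|B f|)%N then k%:R / (#|A f| + #|B f|)%N%:R else 0)%R.
pose w f (x : V) (b : bool) := (if b then 1 + h f else 1 - h f)%R.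
have subC b : {subset map fst ((v, b) :: q) <= C} by move=> x xq; rewrite inE.
have AC f x : x \in A f -> x \notin C.
  by move=> xA; rewrite inE; exact: (region_path (orient_tournament f).1 xA).
have BC f x : x \in B f -> x \notin C.
  by move=> xA; rewrite inE; exact: (region_path (orient_tournament f).1 xA).
have AB f : [disjoint A f & B f].
  rewrite disjoint_subset; apply/fintype.subsetP => x; rewrite !inE /= => /andP[xv _].
  by rewrite (tournament_asym (orient_tournament f) xv).
have Ar f : A (expose C f) = A f by exact: region_expose.
have Br f : B (expose C f) = B f by exact: region_expose.
have wr f : w (expose C f) = w f by rewrite /w /h Ar Br.
have ws f (x : V) : (w f x true + w f x false = 2)%R by rewrite /w; lra.
have h_bound f : (0 <= h f <= 1)%R.
  rewrite /h; case: ifP => [km|_]; last lra.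
  rewrite divr_ge0 //=.
  have [->|m_gt0] := posnP (#|A f| + #|B f|); first by rewrite invr0 mulr0.
  by rewrite ler_pdivrMr ?ltr0n // mul1r ler_nat (leq_trans _ km) // leq_pmull.
have w0 f (x : V) b : (0 <= w f x b)%R.
  by rewrite /w; case: b; have := h_bound f; lra.
apply: (markov_weight AC BC AB Ar Br wr ws w0) => f.
move=> /and3P[m_gt0 km lt_e].
rewrite /weight /w prod_bias /h km; apply: bias_weight => //.
by rewrite !cardE cross_le.
Qed.

(** D vertices together with D common descendants fix D ^ 2 coins; this has
    probability 2 ^ (- D ^ 2), while there are at most 2 ^ (D ^ 2 - D)
    choices. Weight 2 for the prescribed outcome of a coin and 0 for the other
    one makes this an instance of the weight argument. *)
Lemma card_deep (R : realType) :
  (4 * #|[pred f | [exists p : D.-tuple (V * bool) * D.-tuple V,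
     [&& uniq (map fst p.1), uniq p.2 & all (mem (region (orient f) p.1)) p.2]]]|%:R
   <= #|{: coins}|%:R :> R)%R.
Proof.
apply: (union_bound (c := (2 ^+ (D * D))%R)).
  rewrite -natrX -natrM ler_nat card_prod !card_tuple card_prod card_bool card_ord.
  rewrite -[4]/(2 ^ 2) (@leq_trans (2 ^ 2 * ((2 ^ k.+1) ^ D * (2 ^ k) ^ D))) //.
    by rewrite leq_mul // leq_mul // leq_exp2r // ?expnS; lia.
  by rewrite -!expnM -!expnD leq_exp2l // /D; nia.
move=> [q S] /=.
pose A (_ : coins) := [set x in map fst q].
pose B (_ : coins) := [set x in S].
(* The sets A and B do not depend on the coins; if they meet, the event is *)
(* impossible.                                                             *)
have [AB|nAB] := boolP [disjoint A [ffun=> false] & B [ffun=> false]]; last first.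
  rewrite (_ : #|_| = 0) ?mulr0 //; apply: eq_card0 => f; rewrite !inE.
  apply/negP => /and3P[_ _ /allP qS]; case/negP: nAB.
  rewrite disjoint_sym disjoint_subset; apply/fintype.subsetP => x; rewrite !inE => /qS xq.
  exact: (region_path (orient_tournament f).1 xq).
pose w (_ : coins) (x : V) (b : bool) : R := (if ((x, true) \in (q : seq _)) == b then 2 else 0)%R.
have w0 f (x : V) b : (0 <= w f x b)%R by rewrite /w; case: ifP.
have ws f (x : V) : (w f x true + w f x false = 2)%R.
  by rewrite /w; case: (_ \in _); rewrite /= ?addr0 ?add0r.
apply: (markov_weight (C := finset.set0) (A := A) (B := B) (w := w)) => // [f x _|f x _|f].
- by rewrite inE.
- by rewrite inE.
move=> /and3P[uniq_q uniq_S /allP qS].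
rewrite /weight (eq_bigr (fun=> 2 ^+ D)%R) => [|x]; last first.
  rewrite inE => /mapP[[a b] abq -> /=].
  rewrite (eq_bigr (fun=> 2%R)) => [|y].
    by rewrite prodr_const (_ : #|_| = D) // cardsE (card_uniqP uniq_S) size_tuple.
  rewrite inE => /qS; rewrite !inE => /allP yq.
  have := yq _ abq; rewrite /w /=; case: (b) abq => abq ay.
    by rewrite abq ay eqxx.
  have Nay : orient f a y = false by exact: (tournament_asym (orient_tournament f)).
  rewrite Nay ifT //; apply/eqP/negP => /yq /=; by rewrite Nay.
rewrite prodr_const (_ : #|_| = D) ?exprM //.
by rewrite cardsE (card_uniqP uniq_q) size_map size_tuple.
Qed.

(** The two kinds of bad events have probability at most 1 / 4 each. *)
Lemma good_orientation (R : realType) : exists f,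
  (forall q v, size q < D -> ~~ skewed f q v) /\
  (forall q, size q = D -> uniq (map fst q) -> #|region (orient f) q| < D).
Proof.
have := card_deep R; have := card_skewed R.
set X := [pred f | _]; set Y := [pred f | _] => cX cY.
have [f /= | XY] := pickP [pred f : coins | ~~ X f && ~~ Y f]; last first.
  suff : #|{: coins}| <= #|X| + #|Y|.
    have : (0 < #|{: coins}|%:R :> R)%R by rewrite ltr0n; apply/card_gt0P; exists [ffun=> false].
    by rewrite -(ler_nat R) natrD; lra.
  rewrite -cardUI (leq_trans _ (leq_addr _ _)) // subset_leq_card //.
  apply/fintype.subsetP => f _; rewrite inE; have /= := XY f.
  by rewrite -negb_or => /negbFE.
move=> /andP[/existsPn NX /existsPn NY]; exists f; split=> q.
  move=> v sz_q.
  have sz : size (map Some q ++ nseq (D - size q) None) == D.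
    by rewrite size_cat size_map size_nseq subnKC // ltnW.
  have := NX (Tuple sz, v); congr (~~ skewed _ _ _).
  rewrite /= pmap_cat; have -> : pmap id (nseq (D - size q) (@None (V * bool))) = [::].
    by elim: (D - size q).
  by rewrite cats0; elim: (q) => //= x s ->.
move=> /eqP sz_q uniq_q; rewrite ltnNge; apply/negP => D_le.
have sz : size (take D (enum (region (orient f) q))) == D.
  by rewrite size_takel // -cardE.
have /negP := NY (Tuple sz_q, Tuple sz); apply; apply/and3P; split=> //=.
  by rewrite take_uniq ?enum_uniq.
by apply/allP => x /mem_take; rewrite mem_enum.
Qed.

Section Tree.
Variable f : coins.
Notation G := (orient f).
Hypothesis not_skewed : forall q v, size q < D -> ~~ skewed f q v.
Hypothesis shallow : forall q, size q = D -> uniq (map fst q) -> #|region G q| < D.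

(** Above level D, a vertex with l + r descendants costs at most
    (3 k + 9) (l + r) in excess; at level D the subtrees have less than D
    vertices, and the trivial bound on their forward edges suffices. *)
Lemma forward_region (T : bintree V) q :
  size q <= D -> uniq (map fst q) -> shortcut_tree G T ->
  perm_eq (inorder T) (enum (region G q)) ->
  2 * forward G (inorder T) <=
    'C(size (inorder T), 2) + ((D - size q) * (3 * k + 9) + D) * size (inorder T).
Proof.
elim: T q => [|l IHl v r IHr] q; first by [].
move=> q_le uniq_q tT pT; set m := size _.
have mE : m = #|region G q| by rewrite cardE; exact: perm_size pT.
have [qD|q_lt] := eqVneq (size q) D.
  have := shallow qD uniq_q; rewrite -mE qD subnn mul0n add0n => m_lt.
  have := forward_le_sq G (inorder (Node l v r)); rewrite -/m => h.
  apply: (leq_trans h).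
  have : m * m.-1 <= D * m by rewrite mulnC leq_mul2r; apply/orP; right; lia.
  by lia.
have {q_lt}q_lt : size q < D by rewrite ltn_neqAle q_lt.
have irrG := (orient_tournament f).1.
have memT u : (u \in region G q) = (u \in inorder (Node l v r)).
  by rewrite (perm_mem pT) mem_enum.
have v_reg : v \in region G q by rewrite memT mem_cat mem_head orbT.
have uniqT : uniq (inorder (Node l v r)) by rewrite (perm_uniq pT) enum_uniq.
have := tT => /= /and4P[/allP lv /allP rv tl tr].
have regL : region G ((v, false) :: q) =i inorder l.
  move=> u; rewrite inE /=; have := memT u; rewrite inE => ->.
  rewrite /= mem_cat in_cons; case: (boolP (u \in inorder l)) => [/lv -> //|_] /=.
  apply/negP => /andP[uv /orP[/eqP uv'|/rv]].
    by move: uv; rewrite uv' irrG.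
  by rewrite (tournament_asym (orient_tournament f) uv).
have regR : region G ((v, true) :: q) =i inorder r.
  move=> u; rewrite inE /=; have := memT u; rewrite inE => ->.
  rewrite /= mem_cat in_cons; case: (boolP (u \in inorder r)) => [/rv -> //|_] /=.
    by rewrite !orbT.
  rewrite orbF; apply/negP => /andP[vu /orP[/lv|/eqP uv]].
    by rewrite (tournament_asym (orient_tournament f) vu).
  by move: vu; rewrite uv irrG.
move: uniqT; rewrite /= cat_uniq /= => /and4P[uniql _ _ uniqr].
have pl : perm_eq (inorder l) (enum (region G ((v, false) :: q))).
  by apply: uniq_perm; rewrite ?enum_uniq // => u; rewrite mem_enum regL.
have pr : perm_eq (inorder r) (enum (region G ((v, true) :: q))).
  by apply: uniq_perm; rewrite ?enum_uniq // => u; rewrite mem_enum regR.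
have uniq_vq : uniq (v :: map fst q) by rewrite /= uniq_q andbT (region_path irrG v_reg).
have {}IHl := IHl ((v, false) :: q) q_lt uniq_vq tl pl.
have {}IHr := IHr ((v, true) :: q) q_lt uniq_vq tr pr.
have := not_skewed v q_lt; rewrite /skewed.
rewrite -(perm_cross G pl pr) !cardE -(perm_size pl) -(perm_size pr).
move: IHl IHr; rewrite (forward_node tT) /m /= size_cat /= addnS.
set a := size (inorder l); set b := size (inorder r).
set fl := forward _ _; set fr := forward _ _; set e := cross _ _ _ => IHl IHr bal.
have e_le : e <= a * b by exact: cross_le.
have e_bound : 2 * e <= a * b + (3 * k + 8) * (a + b).
  have [ab0|ab_gt0] := posnP (a + b); first by move: ab0 e_le; clear; nia.
  have [k_le|lt_k] := leqP (2 * k) (a + b); last first.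
    have h : a * b <= (a + b) * (2 * k) by rewrite leq_mul ?leq_addr // ltnW // (leq_ltn_trans (leq_addl a b)).
    by move: e_le h; clear; lia.
  by move: bal; rewrite ab_gt0 k_le -leqNgt.
rewrite addnS bin2_node.
have -> : D - size q = (D - (size q).+1).+1 by rewrite subnSK.
move: IHl IHr e_bound => /=; set t := D - _; set c := 3 * k + 8; rewrite mulSn.
set X := t * c.+1 => IHl IHr e_bound.
have -> : (c.+1 + X + D) * (a + b).+1 = (X + D) * a + (X + D) * b + (c * (a + b) + a + b) + (c.+1 + X + D).
  by ring.
by move: IHl IHr e_bound; clear; lia.
Qed.

Lemma shortcuts_le (T : bintree V) :
  spanning_shortcut_tree G T ->
  2 * shortcuts G T <= 'C(n, 2) + (2 * k + 2) * (3 * k + 10) * n.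
Proof.
move=> /andP[sT tT].
have sz : size (inorder T) = n by rewrite (perm_size sT) -cardE card_ord.
have pT : perm_eq (inorder T) (enum (region G [::])).
  by rewrite (permPl sT) (@eq_enum _ _ (region G [::])) // => u; rewrite !inE.
have := @forward_region T [::] (leq0n D) isT tT pT; rewrite sz subn0.
have := path_shortcuts_le_forward G (inorder T); rewrite -/(shortcuts G T) /D.
by lia.
Qed.

End Tree.
End UpperBound.

Lemma t_le (R : realType) (n k : nat) : 5 <= k -> n < 2 ^ k ->
  2 * t n <= 'C(n, 2) + (2 * k + 2) * (3 * k + 10) * n.
Proof.
move=> k5 n_lt; have [f [bal sha]] := good_orientation k5 n_lt R.
rewrite /t; case: ex_maxnP => j /asboolP always _.
have [T sT jT] := always _ _ (card_ord n) (orient_tournament f).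
by apply: leq_trans (_ : 2 * shortcuts (orient f) T <= _); rewrite ?leq_mul2l // shortcuts_le.
Qed.

(** Applied to floor (log2 n) + 1, the preceding bound is 3 n log2 ^ 2 n to
    leading order; with L = log2 n, the full bound
    (L + 2) (3 L + 13) is at most 4 L ^ 2 as soon as L >= 21. *)
Lemma t_le_log (R : realType) (n : nat) : 2 ^ 21 <= n ->
  ((t n)%:R <= 2^-1 * 'C(n, 2)%:R + 4 * n%:R * (log2 n%:R) ^+ 2 :> R)%R.
Proof.
move=> n_ge; have n_gt0 : 0 < n by apply: leq_trans n_ge; rewrite expn_gt0.
have /andP[le_n lt_n] := trunc_log_bounds (isT : 1 < 2) n_gt0.
set k := trunc_log 2 n in le_n lt_n.
have k21 : 21 <= k by apply: trunc_log_max.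
have k5 : 5 <= k.+1 by rewrite ltnS (leq_trans _ k21).
have := t_le R k5 lt_n.
have ln2_gt0 : (0 < ln 2 :> R)%R by rewrite ln_gt0 // ltr1n.
have kL : (k%:R <= log2 (n%:R : R))%R.
  rewrite /log2 ler_pdivlMr // mulr_natl -lnXn // ler_ln ?posrE ?exprn_gt0 ?ltr0n //.
  by rewrite -natrX ler_nat.
have : (21 <= k%:R :> R)%R by rewrite ler_nat.
have : (0 <= n%:R :> R)%R by [].
rewrite -(ler_nat R) -[k.+1]addn1 !(natrM, natrD).
set L := log2 _ in kL *; set K := (k%:R)%R in kL *; set N := (n%:R)%R => N0 K21 H.
have : (N * ((2 * (K + 1) + 2) * (3 * (K + 1) + 10)) <= N * (8 * L ^+ 2))%R.
  apply: ler_wpM2l => //; nra.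
lra.
Qed.

Local Notation eval := Defs.eval.

(** * Reasoning about programs *)

Definition terminates (W : nat) (c : cmd) (s : store) (k : nat) (Q : store -> Prop) :=
  exists k' s', [/\ exec W c s k' s', k' <= k & Q s'].

Definition frame (xs bs : seq nat) (s s' : store) :=
  (forall x, x \notin xs -> var s' x = var s x) /\
  (forall a i, a \notin bs -> arr s' a i = arr s a i).

Definition for_loop (i N : nat) (body : cmd) :=
  Seq (Assign i (Const 0))
    (While (Bin OpLt (Var i) (Var N))
       (Seq body (Assign i (Bin OpAdd (Var i) (Const 1))))).

Section Rules.
Variable W : nat.
Implicit Types (s : store) (Q : store -> Prop).

Lemma terminates_weaken c s k k' Q Q' :
  terminates W c s k Q -> k <= k' -> (forall s', Q s' -> Q' s') ->
  terminates W c s k' Q'.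
Proof.
move=> [j [s' [ex lej Qs']]] le_k QQ'; exists j, s'; split=> //; last exact: QQ'.
exact: leq_trans le_k.
Qed.

Lemma terminates_time c s k k' Q :
  terminates W c s k Q -> k <= k' -> terminates W c s k' Q.
Proof. by move=> t le_k; apply: terminates_weaken t le_k _. Qed.

Lemma terminates_skip s Q : Q s -> terminates W Skip s 1 Q.
Proof. by move=> Qs; exists 1, s; split=> //; exact: ExecSkip. Qed.

Lemma terminates_assign s x e Q :
  fits W s e -> Q (set_var s x (eval s e)) ->
  terminates W (Assign x e) s (cost e).+1 Q.
Proof. by move=> fe Qs; exists (cost e).+1; eexists; split; [exact: ExecAssign | | ]. Qed.

Lemma terminates_put s a i e Q :
  fits W s i -> fits W s e -> Q (set_arr s a (eval s i) (eval s e)) ->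
  terminates W (Put a i e) s (cost i + cost e).+1 Q.
Proof. by move=> fi fe Qs; exists (cost i + cost e).+1; eexists; split; [exact: ExecPut | | ]. Qed.

Lemma terminates_seq c1 c2 s k1 k2 Q :
  terminates W c1 s k1 (fun s1 => terminates W c2 s1 k2 Q) ->
  terminates W (Seq c1 c2) s (k1 + k2).+1 Q.
Proof.
move=> [j1 [s1 [ex1 le1 [j2 [s2 [ex2 le2 Qs2]]]]]].
exists (j1 + j2).+1, s2; split=> //; first exact: ExecSeq ex1 ex2.
by rewrite ltnS leq_add.
Qed.

Lemma terminates_if e c1 c2 s k Q :
  fits W s e ->
  terminates W (if eval s e != 0 then c1 else c2) s k Q ->
  terminates W (If e c1 c2) s (cost e + k).+1 Q.
Proof.
move=> fe [j [s' [ex lej Qs]]]; exists (cost e + j).+1, s'; split=> //.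
  exact: ExecIf.
by rewrite ltnS leq_add2l.
Qed.

Lemma frame_trans xs ys bs cs s1 s2 s3 :
  frame xs bs s1 s2 -> frame ys cs s2 s3 -> frame (xs ++ ys) (bs ++ cs) s1 s3.
Proof.
move=> [v1 a1] [v2 a2]; split=> [x|a i]; rewrite mem_cat negb_or => /andP[h1 h2].
  by rewrite v2 // v1.
by rewrite a2 // a1.
Qed.

Lemma frame_sub xs ys bs cs s1 s2 : {subset xs <= ys} -> {subset bs <= cs} ->
  frame xs bs s1 s2 -> frame ys cs s1 s2.
Proof.
move=> sx sb [v1 a1]; split=> [x|a i] h.
  by rewrite v1 //; apply: contra h => /sx.
by rewrite a1 //; apply: contra h => /sb.
Qed.

Lemma frame_var x s k : frame [:: x] [::] s (set_var s x k).
Proof. by split=> // y; rewrite inE /= => /negbTE ->. Qed.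

Lemma frame_arr a s i k : frame [::] [:: a] s (set_arr s a i k).
Proof. by split=> // b j; rewrite inE /= => /negbTE ->. Qed.

Lemma arr_set_arr s a i k b j :
  arr (set_arr s a i k) b j = if (b == a) && (j == i) then k else arr s b j.
Proof. by []. Qed.

(** The invariant I may not mention the loop variable i; the body may change
    neither i nor the bound N. The constants count the steps of the loop
    test and of the increment. *)
Lemma terminates_for i N body M kb s xs bs (I : nat -> store -> Prop) :
  i \notin xs -> N \notin i :: xs -> var s N = M -> 0 < W -> M <= W ->
  (forall t s1 k, I t s1 -> I t (set_var s1 i k)) ->
  I 0 s ->
  (forall t s1, t < M -> frame (i :: xs) bs s s1 -> var s1 i = t -> I t s1 ->
     terminates W body s1 kb (fun s2 => frame xs bs s1 s2 /\ I t.+1 s2)) ->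
  terminates W (for_loop i N body) s (M * (kb + 9) + 7)
    (fun s' => frame (i :: xs) bs s s' /\ I M s').
Proof.
move=> iNxs NNxs sN W_gt0 M_le I_var I0 step.
set Q := fun s' : store => _.
suff loop d t s1 : t + d = M -> frame (i :: xs) bs s s1 -> var s1 i = t -> I t s1 ->
    terminates W (While (Bin OpLt (Var i) (Var N))
       (Seq body (Assign i (Bin OpAdd (Var i) (Const 1))))) s1 (d * (kb + 9) + 4) Q.
  have -> : M * (kb + 9) + 7 = (2 + (M * (kb + 9) + 4)).+1 by lia.
  apply: terminates_seq; apply: terminates_assign => //=.
  apply: (loop _ 0); rewrite ?add0n //=; last exact: I_var.
    by apply: frame_sub (frame_var i s 0) => // x; rewrite !inE => ->.
  by rewrite eqxx.
elim: d t s1 => [|d IHd] t s1 td fr1 s1i It.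
  have s1N : var s1 N = M by rewrite (fr1.1 _ NNxs).
  rewrite addn0 in td.
  exists 4, s1; split=> //; last by split=> //; rewrite -td.
  by apply: ExecWhileEnd; rewrite /= s1i s1N td ?ltnn //= M_le.
have s1N : var s1 N = M by rewrite (fr1.1 _ NNxs).
have lt_t : t < M by lia.
have [k1 [s2 [ex1 le1 [fr2 I2]]]] := step t s1 lt_t fr1 s1i It.
have s2i : var s2 i = t by rewrite (fr2.1 _ iNxs).
set s3 := set_var s2 i t.+1.
have [|||| k2 [s4 [ex2 le2 Q4]]] := IHd t.+1 s3.
- by lia.
- apply: frame_sub (frame_trans fr1 (frame_trans fr2 (frame_var i s2 t.+1))).
    by move=> x; rewrite !(mem_cat, inE); case: (x == i); case: (x \in xs).
  by move=> x; rewrite !mem_cat in_nil orbF orbb.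
- by rewrite /= eqxx.
- exact: I_var.
exists (3 + (k1 + 4).+1 + k2).+1, s4; split=> //; last by lia.
apply: (@ExecWhileStep _ (Bin OpLt (Var i) (Var N)) _ _ s3) => //=.
- by rewrite s1i s1N lt_t /= W_gt0 M_le ltnW // (leq_trans lt_t).
- by rewrite s1i s1N lt_t.
apply: ExecSeq ex1 _.
have -> : s3 = set_var s2 i (eval s2 (Bin OpAdd (Var i) (Const 1))).
  by rewrite /= s2i addn1.
apply: (@ExecAssign _ _ _ (Bin OpAdd (Var i) (Const 1))).
by rewrite /= s2i addn1 W_gt0 (leq_trans lt_t) //= ltnW // (leq_trans lt_t).
Qed.

End Rules.

(** * The program *)

(* Slots, which code the places for a subtree: 0 is the root, v.+1 is the left  *)
(* and n + v.+1 the right child of v. The array aLab maps every vertex to the   *)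
(* slot below which it is to be placed, or to 2 n + 1 once it has been placed.  *)
Local Notation vN := 0 (only parsing).
Local Notation vRoot := 1 (only parsing).
Local Notation vRem := 2 (only parsing).
Local Notation vI := 3 (only parsing).
Local Notation vG := 4 (only parsing).
Local Notation vM := 5 (only parsing).
Local Notation vP := 6 (only parsing).
Local Notation vQ := 7 (only parsing).
Local Notation vAcc := 8 (only parsing).
Local Notation vV := 9 (only parsing).
Local Notation aAdj := 0 (only parsing).
Local Notation aL := 1 (only parsing).
Local Notation aR := 2 (only parsing).
Local Notation aLab := 3 (only parsing).
Local Notation aMem := 4 (only parsing).
Local Notation aDeg := 5 (only parsing).

Definition adj (e1 e2 : expr) := Get aAdj (Bin OpAdd (Bin OpMul e1 (Var vN)) e2).
Definition mem_at (x : nat) := Get aMem (Var x).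
Definition placed := Bin OpAdd (Bin OpAdd (Var vN) (Var vN)) (Const 1).

(** The slot of some vertex that has not been placed yet. *)
Definition find_group :=
  for_loop vI vN (If (Bin OpLt (Get aLab (Var vI)) placed)
                     (Assign vG (Get aLab (Var vI))) Skip).

(** The vertices of the slot are listed once, so that the quadratic part of a
    round is quadratic in their number only. *)
Definition gather :=
  Seq (Assign vM (Const 0))
    (for_loop vI vN
       (If (Bin OpEq (Get aLab (Var vI)) (Var vG))
          (Seq (Put aMem (Var vM) (Var vI))
             (Assign vM (Bin OpAdd (Var vM) (Const 1))))
          Skip)).

Definition sum_loop (e : expr) :=
  Seq (Assign vAcc (Const 0))
    (for_loop vQ vM (Assign vAcc (Bin OpAdd (Var vAcc) e))).

Definition degrees :=
  for_loop vP vM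
    (Seq (sum_loop (adj (mem_at vP) (mem_at vQ)))
       (Put aDeg (Var vP) (Var vAcc))).

Definition deg_p := Get aDeg (Var vP).
Definition indeg_p := Bin OpSub (Bin OpSub (Var vM) deg_p) (Const 1).

Definition pivot_expr :=
  Bin OpLt
    (Bin OpAdd (Bin OpAdd (Bin OpMul (Const 3) (Bin OpMul indeg_p indeg_p)) indeg_p)
       (Bin OpMul deg_p deg_p))
    (Bin OpAdd (Bin OpAdd (Bin OpMul (Const 4) (Var vAcc)) deg_p) (Const 1)).

Definition choose_pivot :=
  for_loop vP vM
    (Seq (sum_loop (Bin OpMul (adj (mem_at vQ) (mem_at vP)) (Get aDeg (Var vQ))))
       (If pivot_expr (Assign vV (mem_at vP)) Skip)).

(** The label n + v + 1 - n * [u -> v] is the left slot of v if u -> v and the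
    right one otherwise; v itself gets a wrong label, which is then
    overwritten. *)
Definition relabel :=
  Seq
    (for_loop vQ vM
       (Put aLab (mem_at vQ)
          (Bin OpSub (Bin OpAdd (Bin OpAdd (Var vN) (Var vV)) (Const 1))
             (Bin OpMul (Var vN) (adj (mem_at vQ) (Var vV))))))
    (Put aLab (Var vV) placed).

Definition link_pivot :=
  If (Bin OpEq (Var vG) (Const 0))
    (Assign vRoot (Bin OpAdd (Var vV) (Const 1)))
    (If (Bin OpLt (Var vG) (Bin OpAdd (Var vN) (Const 1)))
       (Put aL (Bin OpSub (Var vG) (Const 1)) (Bin OpAdd (Var vV) (Const 1)))
       (Put aR (Bin OpSub (Bin OpSub (Var vG) (Var vN)) (Const 1))
          (Bin OpAdd (Var vV) (Const 1)))).

(** One round chooses the root of the subtree of one slot and distributes the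
    other vertices of the slot to the left and right slots of this root. *)
Definition place_one :=
  Seq find_group (Seq gather (Seq degrees (Seq choose_pivot (Seq relabel
    (Seq link_pivot (Assign vRem (Bin OpSub (Var vRem) (Const 1)))))))).

Definition build_tree :=
  Seq (Assign vRem (Var vN)) (While (Var vRem) place_one).

(** * Correctness of one round *)

Section Pieces.
Variables (W n : nat) (G : rel 'I_n).
(* The largest value that occurs is 4 vAcc + deg + 1 in pivot_expr, where vAcc  *)
(* is a sum of at most n outdegrees.                                            *)
Hypotheses (n_gt0 : 0 < n) (W_ge : 10 * n * n <= W).
Implicit Types (s : store).

Let n_le : 3 * n + 1 <= W. Proof. by move: n_gt0 W_ge; clear; nia. Qed.
Let W_gt0 : 0 < W. Proof. by move: n_le; lia. Qed.

Lemma find_group_ok s :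
  var s vN = n -> (forall u : 'I_n, arr s aLab u <= 2 * n + 1) ->
  (exists u : 'I_n, arr s aLab u <= 2 * n) ->
  terminates W find_group s (n * 21 + 7)
    (fun s' => frame [:: vI; vG] [::] s s' /\
       exists u : 'I_n, var s' vG = arr s aLab u /\ arr s aLab u <= 2 * n).
Proof.
move=> sN lab_le [u0 u0_le].
pose I t s1 := (exists2 u : 'I_n, u < t & arr s aLab u <= 2 * n) ->
  exists u : 'I_n, var s1 vG = arr s aLab u /\ arr s aLab u <= 2 * n.
eapply terminates_weaken.
- apply: (@terminates_for W vI vN _ n 12 s [:: vG] [::] I) => //.
  + by move: n_le; lia.
  + by case.
  move=> t s1 lt_t fr s1i It.
  have s1N : var s1 vN = n by rewrite fr.1.
  have lab1 u : arr s1 aLab u = arr s aLab u by rewrite fr.2.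
  have labt := lab_le (Ordinal lt_t); rewrite /= in labt.
  eapply terminates_time.
    eapply terminates_if.
      rewrite /= s1N s1i lab1.
      by move: n_le n_gt0 lt_t labt; case: (_ < _); rewrite /=; lia.
    rewrite /= s1N s1i lab1; case: ifP => [lt_lab|ge_lab].
    + apply: terminates_assign; rewrite /= s1i lab1.
        by move: n_le n_gt0 lt_t labt; lia.
      split; first exact: frame_var.
      by move=> _; exists (Ordinal lt_t) => /=; split=> //; move: lt_lab; case: ltnP => //; lia.
    + apply: (@terminates_time _ _ _ 1 3) => //.
      apply: terminates_skip; split=> // -[u]; rewrite ltnS leq_eqVlt => /orP[/eqP ut|lt_u] le_u.
        by move: ge_lab; rewrite -ut; case: ltnP => //; lia.
      by apply: It; exists u.
  by [].
- by lia.
by move=> s' [fr I']; split=> //; apply: I'; exists u0.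
Qed.

Definition members s g : seq 'I_n := [seq u : 'I_n <- enum 'I_n | arr s aLab u == g].

(** The memory from the moment on when the vertices ms of a slot are listed. *)
Definition ready s (ms : seq 'I_n) :=
  [/\ var s vN = n, (forall i j : 'I_n, arr s aAdj (i * n + j) = G i j),
      var s vM = size ms &
      forall x0 j, j < size ms -> arr s aMem j = nth x0 ms j].

Lemma ready_frame xs bs s s' ms : frame xs bs s s' ->
  all (fun x => x \notin xs) [:: vN; vM] ->
  all (fun a => a \notin bs) [:: aAdj; aMem] -> ready s ms -> ready s' ms.
Proof.
move=> [v1 a1] /and3P[xN xM _] /and3P[bA bM _] [sN sA sM sm]; split.
- by rewrite v1.
- by move=> i j; rewrite a1.
- by rewrite v1.
by move=> x0 j jm; rewrite a1 //; exact: sm.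
Qed.

Lemma gather_ok s (ms := members s (var s vG)) :
  var s vN = n -> (forall i j : 'I_n, arr s aAdj (i * n + j) = G i j) ->
  (forall u : 'I_n, arr s aLab u <= 2 * n + 1) -> var s vG <= 2 * n ->
  terminates W gather s (n * 22 + 10)
    (fun s' => frame [:: vI; vM] [:: aMem] s s' /\ ready s' ms).
Proof.
move=> sN sA lab_le g_le.
pose us t := [seq u <- iota 0 t | arr s aLab u == var s vG].
pose I t s1 := var s1 vM = size (us t) /\
  forall j, j < size (us t) -> arr s1 aMem j = nth 0 (us t) j.
have us_le t : size (us t) <= t by rewrite size_filter (leq_trans (count_size _ _)) ?size_iota.
eapply terminates_time.
- apply: terminates_seq; apply: terminates_assign => //=.
  eapply terminates_weaken.
  + apply: (@terminates_for W vI vN _ n 13 _ [:: vM] [:: aMem] I) => //.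
      by move: n_le; lia.
    move=> t s1 lt_t fr s1i [mE memE].
    have s1N : var s1 vN = n by rewrite fr.1.
    have s1g : var s1 vG = var s vG by rewrite fr.1.
    have lab1 u : arr s1 aLab u = arr s aLab u by rewrite fr.2.
    have labt := lab_le (Ordinal lt_t); rewrite /= in labt.
    have ust : us t.+1 = if arr s aLab t == var s vG then rcons (us t) t else us t.
      by rewrite /us -[t.+1]addn1 iotaD filter_cat /= add0n; case: ifP; rewrite ?cats1 ?cats0.
    eapply terminates_time.
      eapply (@terminates_if _ _ _ _ _ 8).
        rewrite /= s1g s1i lab1.
        by move: n_le n_gt0 lt_t labt g_le; case: (_ == _); rewrite /=; lia.
      rewrite /= s1g s1i lab1 eqb0 negbK; case: ifP => [lab_t|lab_t].
      * apply: (@terminates_seq _ _ _ _ 3 4); apply: terminates_put => /=.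
        - by rewrite mE; move: n_le (us_le t) lt_t; lia.
        - by rewrite s1i; move: n_le lt_t; lia.
        apply: terminates_assign => /=.
          by rewrite mE; move: n_le (us_le t) lt_t; lia.
        split.
          by apply: frame_sub (frame_trans (frame_arr aMem s1 _ _) (frame_var vM _ _)) => x.
        rewrite /I; have -> : us t.+1 = rcons (us t) t by rewrite ust lab_t.
        rewrite /=.
        rewrite size_rcons mE addn1; split=> // j; rewrite ltnS nth_rcons.
        case: eqP => [->|ne]; first by rewrite ltnn s1i.
        rewrite leq_eqVlt; case: eqP => [//|_] /= jlt; rewrite jlt; exact: memE.
      * apply: (@terminates_time _ _ _ 1 8) => //.
        apply: terminates_skip; split=> //; rewrite /I.
        by have -> // : us t.+1 = us t by rewrite ust lab_t.
    by [].
  + exact: leqnn.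
  move=> s' [fr [mE memE]]; split.
    apply: frame_sub (frame_trans (frame_var vM s 0) fr) => x; rewrite !(mem_cat, inE) //.
    by case: (x == vM); rewrite ?orbT.
  have usE : us n = map val ms.
    by rewrite /us -val_enum_ord filter_map.
  split.
  + by rewrite fr.1.
  + by move=> i j; rewrite fr.2 //; exact: sA.
  + by rewrite mE usE size_map.
  by move=> x0 j jm; rewrite memE usE ?size_map // (nth_map x0).
by rewrite /=; lia.
Qed.

Lemma adj_ok s ms e1 e2 (u v : 'I_n) : ready s ms ->
  fits W s e1 -> fits W s e2 -> eval s e1 = u -> eval s e2 = v ->
  fits W s (adj e1 e2) /\ eval s (adj e1 e2) = G u v.
Proof.
move=> [sN sA _ _] f1 f2 E1 E2; rewrite /= E1 E2 sN sA f1 f2; split=> //.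
have := ltn_ord u; have := ltn_ord v; move: n_le W_ge W_gt0; clear.
by case: (G u v) => /=; nia.
Qed.

Lemma mem_at_ok s (ms : seq 'I_n) x j (x0 : 'I_n) : ready s ms -> var s x = j -> j < size ms -> size ms <= n ->
  fits W s (mem_at x) /\ eval s (mem_at x) = nth x0 ms j.
Proof.
move=> [_ _ _ sm] sx jm mn; rewrite /= sx (sm x0) //; split=> //.
by have := ltn_ord (nth x0 ms j); move: n_le; lia.
Qed.

(** The bound n on the terms keeps all partial sums within a word. *)
Lemma sum_loop_ok s m e (F : nat -> nat) :
  var s vM = m -> m <= n -> (forall q, q < m -> F q <= n) ->
  (forall q s1, q < m -> frame [:: vQ; vAcc] [::] s s1 -> var s1 vQ = q ->
     fits W s1 e /\ eval s1 e = F q) ->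
  terminates W (sum_loop e) s (m * (cost e + 12) + 10)
    (fun s' => frame [:: vQ; vAcc] [::] s s' /\ var s' vAcc = \sum_(q < m) F q).
Proof.
move=> sM m_le F_le e_ok.
pose I t s1 := var s1 vAcc = \sum_(q < t) F q /\ var s1 vAcc <= t * n.
eapply terminates_time.
- apply: terminates_seq; apply: terminates_assign => //=.
  eapply terminates_weaken.
  + apply: (@terminates_for W vQ vM _ m (cost e + 3) _ [:: vAcc] [::] I) => //.
    * by move: n_le m_le; lia.
    * by rewrite /I /= big_ord0.
    move=> t s1 lt_t fr s1q [accE acc_le].
    have frs : frame [:: vQ; vAcc] [::] s s1.
      apply: frame_sub (frame_trans (frame_var vAcc s 0) fr) => x; rewrite !(mem_cat, inE) //.
      by case: (x == vAcc); rewrite ?orbT.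
    have [fe Ee] := e_ok t s1 lt_t frs s1q.
    have Ft := F_le t lt_t.
    have acc_le' : var s1 vAcc + F t <= t.+1 * n by rewrite mulSn addnC leq_add.
    have bound : t.+1 * n <= W by move: W_ge lt_t m_le n_gt0; clear; nia.
    eapply terminates_time.
      apply: terminates_assign.
        rewrite /= Ee fe andbT (leq_trans acc_le') //=.
        by rewrite (leq_trans _ bound) // (leq_trans _ acc_le') // leq_addr.
      split; first exact: frame_var.
      by rewrite /I /= Ee big_ord_recr /= -accE.
    by rewrite /=; lia.
  + exact: leqnn.
  move=> s' [fr [accE _]]; split=> //.
  apply: frame_sub (frame_trans (frame_var vAcc s 0) fr) => x; rewrite !(mem_cat, inE) //.
  by case: (x == vAcc); rewrite ?orbT.
by rewrite /=; lia.
Qed.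

Lemma sum_nth (x0 : 'I_n) (ms : seq 'I_n) (F : 'I_n -> nat) :
  \sum_(q < size ms) F (nth x0 ms q) = \sum_(u <- ms) F u.
Proof. by rewrite (big_nth x0) big_mkord. Qed.

Lemma degrees_ok s (ms : seq 'I_n) (x0 : 'I_n) : ready s ms -> size ms <= n ->
  terminates W degrees s (size ms * (size ms * 20 + 23) + 7)
    (fun s' => frame [:: vP; vQ; vAcc] [:: aDeg] s s' /\
       forall j, j < size ms -> arr s' aDeg j = count (G (nth x0 ms j)) ms).
Proof.
move=> rdy m_le; have [sN sA sM sm] := rdy.
pose I t s1 := forall j, j < t -> arr s1 aDeg j = count (G (nth x0 ms j)) ms.
apply: terminates_time; last first.
  by apply: (_ : size ms * (size ms * 20 + 14 + 9) + 7 <= _); rewrite -addnA.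
apply: (@terminates_for W vP vM _ (size ms) _ _ [:: vQ; vAcc] [:: aDeg] I) => //.
  by move: n_le m_le; lia.
move=> t s1 lt_t fr s1p It.
have rdy1 : ready s1 ms by apply: ready_frame fr _ _ rdy.
eapply terminates_time.
- apply: terminates_seq; eapply terminates_weaken.
  + apply: (sum_loop_ok (m := size ms) (F := fun q => G (nth x0 ms t) (nth x0 ms q))) => //.
    * by rewrite fr.1.
    * by move=> q _; case: (G _ _).
    move=> q s2 lt_q fr2 s2q.
    have rdy2 : ready s2 ms by apply: ready_frame fr2 _ _ rdy1.
    have s2p : var s2 vP = t by rewrite fr2.1.
    have [f1 E1] := mem_at_ok x0 rdy2 s2p lt_t m_le.
    have [f2 E2] := mem_at_ok x0 rdy2 s2q lt_q m_le.
    exact: adj_ok rdy2 f1 f2 E1 E2.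
  + exact: leqnn.
  move=> s2 [fr2 accE].
  have s2p : var s2 vP = t by rewrite fr2.1.
  have accE' : var s2 vAcc = count (G (nth x0 ms t)) ms.
    by rewrite accE (sum_nth x0 ms (G (nth x0 ms t))) -sum1_count [RHS]big_mkcond.
  have c_le := count_size (G (nth x0 ms t)) ms.
  apply: terminates_put => /=.
  + by rewrite s2p; move: n_le m_le lt_t; lia.
  + by rewrite accE'; move: n_le m_le c_le; lia.
  split.
    by apply: frame_sub (frame_trans fr2 (frame_arr aDeg s2 _ _)) => x; rewrite !(mem_cat, inE) ?orbF.
  move=> j; rewrite ltnS /= s2p accE' leq_eqVlt.
  by case: eqP => [-> //|_] /= lt_j; rewrite fr2.2 // It.
by rewrite /=; lia.
Qed.

Lemma choose_pivot_ok s (ms : seq 'I_n) (x0 : 'I_n) : tournament G -> uniq ms -> ms != [::] ->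
  ready s ms ->
  (forall j, j < size ms -> arr s aDeg j = count (G (nth x0 ms j)) ms) ->
  terminates W choose_pivot s (size ms * (size ms * 23 + 61) + 7)
    (fun s' => frame [:: vP; vQ; vAcc; vV] [::] s s' /\
       exists v, [/\ v \in ms, pivot_test G ms v & var s' vV = v]).
Proof.
move=> [irrG totG] uniq_ms ms_n0 rdy degE; have [sN sA sM sm] := rdy.
have m_le : size ms <= n.
  by rewrite -(card_uniqP uniq_ms) -[leqRHS]card_ord max_card.
have m_W : size ms <= W by move: n_le m_le; lia.
pose I t s1 := (exists2 j, j < t & pivot_test G ms (nth x0 ms j)) ->
  exists v, [/\ v \in ms, pivot_test G ms v & var s1 vV = v].
eapply terminates_weaken.
- apply: (@terminates_for W vP vM _ (size ms) (size ms * 23 + 52) _ [:: vQ; vAcc; vV] [::] I) => //.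
  + by case.
  move=> t s1 lt_t fr s1p It.
  have rdy1 : ready s1 ms by apply: ready_frame fr _ _ rdy.
  set v := nth x0 ms t; have v_ms : v \in ms by exact: mem_nth.
  have deg1 j : j < size ms -> arr s1 aDeg j = count (G (nth x0 ms j)) ms.
    by move=> jm; rewrite fr.2 // degE.
  eapply terminates_time.
  + apply: terminates_seq; eapply terminates_weaken.
    * apply: (sum_loop_ok (m := size ms)
        (F := fun q => G (nth x0 ms q) v * count (G (nth x0 ms q)) ms)) => //.
      - by rewrite fr.1.
      - move=> q _; rewrite (leq_trans _ m_le) // (leq_trans _ (count_size (G (nth x0 ms q)) ms)) //.
        by case: (G _ v); rewrite ?mul1n.
      move=> q s2 lt_q fr2 s2q.
      have rdy2 : ready s2 ms by apply: ready_frame fr2 _ _ rdy1.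
      have s2p : var s2 vP = t by rewrite fr2.1.
      have [f1 E1] := mem_at_ok x0 rdy2 s2p lt_t m_le.
      have [f2 E2] := mem_at_ok x0 rdy2 s2q lt_q m_le.
      have [fa Ea] := adj_ok rdy2 f2 f1 E2 E1.
      have Ed : eval s2 (Get aDeg (Var vQ)) = count (G (nth x0 ms q)) ms.
        by rewrite /= s2q fr2.2 // deg1.
      have c_le := count_size (G (nth x0 ms q)) ms.
      have fd : fits W s2 (Get aDeg (Var vQ)).
        move: Ed; rewrite /= s2q => ->.
        by rewrite (leq_trans c_le m_W) (leq_trans (ltnW lt_q) m_W).
      have E : eval s2 (Bin OpMul (adj (mem_at vQ) (mem_at vP)) (Get aDeg (Var vQ)))
          = G (nth x0 ms q) v * count (G (nth x0 ms q)) ms by rewrite -Ea -Ed.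
      split=> //; apply/and3P; split=> //.
      rewrite E (leq_trans _ m_W) // (leq_trans _ c_le) //.
      by case: (G _ v); rewrite ?mul1n.
    * exact: leqnn.
    move=> s2 [fr2 accE].
    have s2p : var s2 vP = t by rewrite fr2.1.
    have s2M : var s2 vM = size ms by rewrite fr2.1 // fr.1.
    have s2d : arr s2 aDeg t = size (outn G ms v) by rewrite fr2.2 // deg1 // size_filter.
    have accE' : var s2 vAcc = \sum_(u <- inn G ms v) count (G u) ms.
      rewrite accE (sum_nth x0 ms (fun u => G u v * count (G u) ms)) big_filter [RHS]big_mkcond.
      by apply: eq_bigr => u _; case: (G u v); rewrite ?mul1n.
    have sz := size_nbrs irrG totG uniq_ms v_ms.
    have acc_le : var s2 vAcc <= n * n.
      rewrite accE'; apply: (@leq_trans (\sum_(u <- inn G ms v) n)).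
        by apply: leq_sum => u _; rewrite (leq_trans (count_size _ _)).
      by rewrite big_const_seq count_predT iter_addn_0 leq_mul2l (leq_trans _ m_le) ?orbT // size_filter count_size.
    have indegE : size ms - size (outn G ms v) - 1 = size (inn G ms v) by rewrite sz -addSn addnK subn1.
    have testE : eval s2 pivot_expr = pivot_test G ms v.
      rewrite /= s2p s2M s2d indegE /pivot_test accE' addn1 ltnS -!mulnn.
      by congr (nat_of_bool (_ <= _)).
    apply: (@terminates_if _ _ _ _ _ 3).
      rewrite /= s2p s2M s2d indegE.
      have ld : size (inn G ms v) + size (outn G ms v) < n by rewrite -sz.
      have t_W : t <= W by rewrite (leq_trans (ltnW lt_t)).
      move: W_ge n_gt0 W_gt0 acc_le ld t_W m_W; clear.
      set l := size (inn _ _ _); set d := size (outn _ _ _); set acc := var _ _.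
      set z := size ms; move=> W_ge n_gt0 W_gt0 acc_le ld t_W m_W.
      have l2 : l * l <= n * n by apply: leq_mul; lia.
      have d2 : d * d <= n * n by apply: leq_mul; lia.
      have n1 : n <= n * n by apply: leq_pmulr.
      by case: (_ < _) => /=; lia.
    rewrite testE; case: (boolP (pivot_test G ms v)) => [piv|npiv] /=.
      have rdy2 : ready s2 ms by apply: ready_frame fr2 _ _ rdy1.
      have [f1 E1] := mem_at_ok x0 rdy2 s2p lt_t m_le.
      apply: terminates_assign => //; split.
        by apply: frame_sub (frame_trans fr2 (frame_var vV s2 _)) => x.
      by move=> _; exists v; split=> //=; rewrite -E1.
    apply: (@terminates_time _ _ _ 1 3) => //; apply: terminates_skip; split.
      apply: frame_sub fr2 => x; rewrite !inE //.
      by case/orP => ->; rewrite ?orbT.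
    move=> [j]; rewrite ltnS leq_eqVlt => /orP[/eqP -> |lt_j] pj; first by rewrite pj in npiv.
    have [|w [w1 w2 w3]] := It; first by exists j.
    by exists w; split=> //; rewrite fr2.1.
  by rewrite /=; lia.
- by lia.
move=> s' [fr I']; split=> //; apply: I'.
have [v v_ms piv] := pivot_exists irrG totG uniq_ms ms_n0.
by exists (index v ms); rewrite ?index_mem // nth_index.
Qed.

Definition new_label (ms : seq 'I_n) (v u : 'I_n) (old : nat) :=
  if u \in ms then
    if u == v then 2 * n + 1 else if G u v then v.+1 else n + v.+1
  else old.

Lemma relabel_ok s (ms : seq 'I_n) (v : 'I_n) : uniq ms -> v \in ms ->
  ready s ms -> var s vV = v ->
  terminates W relabel s (size ms * 27 + 15)
    (fun s' => frame [:: vQ] [:: aLab] s s' /\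
       forall u : 'I_n, arr s' aLab u = new_label ms v u (arr s aLab u)).
Proof.
move=> uniq_ms v_ms rdy sV; have [sN sA sM sm] := rdy.
have m_le : size ms <= n.
  by rewrite -(card_uniqP uniq_ms) -[leqRHS]card_ord max_card.
have m_W : size ms <= W by rewrite (leq_trans m_le) //; move: n_le; clear; lia.
have n_W : 2 * n + 1 <= W by move: n_le; lia.
have v_lt := ltn_ord v.
pose I t s1 := forall u : 'I_n, arr s1 aLab u =
  if u \in take t ms then if G u v then v.+1 else n + v.+1 else arr s aLab u.
eapply terminates_time.
- apply: terminates_seq; eapply terminates_weaken.
  + apply: (@terminates_for W vQ vM _ (size ms) 18 _ [::] [:: aLab] I) => //.
      by move=> u; rewrite take0.
    move=> t s1 lt_t fr s1q It.
    have rdy1 : ready s1 ms by apply: ready_frame fr _ _ rdy.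
    have s1N : var s1 vN = n by rewrite fr.1.
    have s1V : var s1 vV = v by rewrite fr.1.
    have [f1 E1] := mem_at_ok v rdy1 s1q lt_t m_le.
    have fV : fits W s1 (Var vV) by rewrite /= s1V; move: n_W v_lt; clear; lia.
    have [fa Ea] := @adj_ok s1 ms (mem_at vQ) (Var vV) (nth v ms t) v rdy1 f1 fV E1 s1V.
    set e := Bin OpSub _ _.
    have Ee : eval s1 e = if G (nth v ms t) v then v.+1 else n + v.+1.
      rewrite /e [eval _ _]/(var s1 vN + var s1 vV + 1 - var s1 vN * eval s1 (adj (mem_at vQ) (Var vV))).
      rewrite Ea s1N s1V; case: (G _ _); lia.
    apply: terminates_put => //.
      apply/and3P; split.
      * by rewrite Ee; move: n_W v_lt; clear; case: (G _ _); lia.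
      * by rewrite /= s1N s1V; move: n_W v_lt W_gt0; clear; lia.
      * apply/and3P; split; last exact: fa; last 1 first.
        - by rewrite /= s1N; move: n_W; clear; lia.
        - rewrite [eval _ _]/(var s1 vN * eval s1 (adj (mem_at vQ) (Var vV))) Ea s1N.
          by move: n_W; clear; case: (G _ _) => /=; lia.
    split; first exact: frame_arr.
    move=> u; rewrite arr_set_arr E1 Ee eqxx andTb (inj_eq val_inj) (take_nth v) // mem_rcons in_cons.
    by case: eqP => [-> //|_]; exact: It.
  + exact: leqnn.
  move=> s1 [fr It].
  have s1N : var s1 vN = n by rewrite fr.1.
  have s1V : var s1 vV = v by rewrite fr.1.
  apply: terminates_put.
  + by rewrite /= s1V; move: n_W v_lt; lia.
  + by rewrite /= s1N; move: n_W n_gt0 W_gt0; lia.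
  split.
    by apply: frame_sub (frame_trans fr (frame_arr aLab s1 _ _)) => x; rewrite ?mem_cat ?in_cons ?in_nil ?orbF ?orbb.
  move=> u; rewrite /= s1V s1N (inj_eq val_inj) /new_label.
  case: (eqVneq u v) => [->|ne]; first by rewrite v_ms; lia.
  by rewrite It take_size.
by rewrite /=; lia.
Qed.

(** The slots are spread over a variable and two arrays, where the absent child
    of a vertex is coded by the initial value 0. *)
Definition link s h :=
  if h == 0 then var s vRoot
  else if h <= n then arr s aL h.-1 else arr s aR (h - n).-1.

Lemma link_pivot_ok s (v : 'I_n) : var s vN = n -> var s vG <= 2 * n -> var s vV = v ->
  terminates W link_pivot s 40
    (fun s' => frame [:: vRoot] [:: aL; aR] s s' /\
       forall h, h <= 2 * n -> link s' h = if h == var s vG then v.+1 else link s h).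
Proof.
move=> sN g_le sV; have v_lt := ltn_ord v.
have n_W : 2 * n + 1 <= W by move: n_le; lia.
set g := var s vG in g_le *.
eapply terminates_time.
- eapply (@terminates_if _ _ _ _ _ 30).
    by rewrite /= -/g; move: n_W g_le W_gt0; clear; case: (g == 0) => /=; lia.
  rewrite /= -/g eqb0 negbK; case: eqP => [g0|/eqP g0].
    apply: (@terminates_time _ _ _ 4) => //.
    apply: terminates_assign; first by rewrite /= sV; move: n_W v_lt; clear; lia.
    split; first by apply: frame_sub (frame_var vRoot s _).
    move=> h h_le; rewrite g0 /link /= sV addn1; by case: (h == 0).
  eapply terminates_time.
    eapply (@terminates_if _ _ _ _ _ 20).
      by rewrite /= -/g sN; move: n_W g_le n_gt0 W_gt0; clear; case: (_ < _) => /=; lia.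
    rewrite /= -/g sN addn1 ltnS eqb0 negbK; case: leqP => [g_n|n_g].
      apply: (@terminates_time _ _ _ (3 + 3).+1) => //.
      apply: terminates_put.
      + by rewrite /= -/g; move: n_W g_le W_gt0; clear; lia.
      + by rewrite /= sV; move: n_W v_lt W_gt0; clear; lia.
      split; first by apply: frame_sub (frame_arr aL s _ _) => x; rewrite !inE // => ->.
      move=> h h_le; rewrite /link /= -/g sV addn1.
      have [->|h0] := eqVneq h 0; first by rewrite eq_sym (negbTE g0).
      have [h_n|n_h] := leqP h n.
        by have -> : (h.-1 == g - 1) = (h == g) by move: h0 g0; clear; lia.
      by case: eqP => // hg; move: n_h g_n; rewrite hg; clear; lia.
    apply: (@terminates_time _ _ _ (5 + 3).+1) => //.
    apply: terminates_put.
    + by rewrite /= -/g sN; move: n_W g_le W_gt0; clear; lia.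
    + by rewrite /= sV; move: n_W v_lt W_gt0; clear; lia.
    split; first by apply: frame_sub (frame_arr aR s _ _) => x; rewrite !inE // => ->; rewrite orbT.
    move=> h h_le; rewrite /link /= -/g sV sN addn1.
    have [->|h0] := eqVneq h 0; first by rewrite eq_sym (negbTE g0).
    have [h_n|n_h] := leqP h n.
      by case: eqP => // hg; move: n_g h_n; rewrite hg; clear; lia.
    by have -> : ((h - n).-1 == g - n - 1) = (h == g) by move: n_h n_g; clear; lia.
  by [].
by [].
Qed.

Definition round_store s :=
  [/\ var s vN = n,
      forall i j : 'I_n, arr s aAdj (i * n + j) = G i j &
      forall u : 'I_n, arr s aLab u <= 2 * n + 1].

Definition round_step s g (v : 'I_n) s' :=
  [/\ var s' vN = n, var s' vRem = var s vRem - 1,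
      (forall i j : 'I_n, arr s' aAdj (i * n + j) = G i j),
      (forall u : 'I_n, arr s' aLab u = new_label (members s g) v u (arr s aLab u)) &
      forall h, h <= 2 * n -> link s' h = if h == g then v.+1 else link s h].

(** The slot g and the vertex v are named before the time bound because the
    bound depends on the number of vertices in the slot g. *)
Lemma place_one_ok s : tournament G -> round_store s -> var s vRem <= n ->
  (exists u : 'I_n, arr s aLab u <= 2 * n) ->
  exists g v, [/\ g <= 2 * n, v \in members s g, pivot_test G (members s g) v &
    terminates W place_one s (300 * (n + size (members s g) ^ 2)) (round_step s g v)].
Proof.
move=> tG [sN sA lab_le] rem_le unplaced.
have [k1 [s1 [ex1 le1 [fr1 [u [gE u_le]]]]]] := find_group_ok sN lab_le unplaced.
set g := var s1 vG in gE; exists g.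
have lab1 x : arr s1 aLab x = arr s aLab x by rewrite fr1.2.
have memE : members s1 g = members s g by apply: eq_filter => x /=; rewrite lab1.
set ms := members s g in memE *.
have g_le : g <= 2 * n by rewrite gE.
have uniq_ms : uniq ms by rewrite filter_uniq ?enum_uniq.
have u_ms : u \in ms by rewrite mem_filter mem_enum gE eqxx.
have ms_n0 : ms != [::] by apply: contraTneq u_ms => ->.
have m_le : size ms <= n.
  by rewrite -(card_uniqP uniq_ms) -[leqRHS]card_ord max_card.
have s1N : var s1 vN = n by rewrite fr1.1.
have s1A (i j : 'I_n) : arr s1 aAdj (i * n + j) = G i j by rewrite fr1.2.
have lab_le1 (x : 'I_n) : arr s1 aLab x <= 2 * n + 1 by rewrite lab1.
have [k2 [s2 [ex2 le2 [fr2 rdy2]]]] := gather_ok s1N s1A lab_le1 g_le.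
rewrite -/g memE in rdy2.
have [k3 [s3 [ex3 le3 [fr3 deg3]]]] := degrees_ok u rdy2 m_le.
have rdy3 : ready s3 ms by apply: ready_frame fr3 _ _ rdy2.
have [k4 [s4 [ex4 le4 [fr4 [v [v_ms piv vE]]]]]] :=
  choose_pivot_ok tG uniq_ms ms_n0 rdy3 deg3.
have rdy4 : ready s4 ms by apply: ready_frame fr4 _ _ rdy3.
have [k5 [s5 [ex5 le5 [fr5 lab5]]]] := relabel_ok uniq_ms v_ms rdy4 vE.
have rdy5 : ready s5 ms.
  by apply: ready_frame fr5 _ _ rdy4.
have s5V : var s5 vV = v by rewrite fr5.1.
have fr15 := frame_trans fr2 (frame_trans fr3 (frame_trans fr4 fr5)).
have s5g : var s5 vG = g by rewrite fr15.1.
have g_le5 : var s5 vG <= 2 * n by rewrite s5g.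
have [s5N s5A _ _] := rdy5.
have [k6 [s6 [ex6 le6 [fr6 link6]]]] := link_pivot_ok s5N g_le5 s5V.
have fr16 := frame_trans fr1 (frame_trans fr15 fr6).
have fr05 := frame_trans fr1 fr15.
exists v; split=> //.
set e := Bin OpSub (Var vRem) (Const 1).
exists (k1 + (k2 + (k3 + (k4 + (k5 + (k6 + (cost e).+1).+1).+1).+1).+1).+1).+1, (set_var s6 vRem (eval s6 e)); split.
- apply: ExecSeq ex1 _; apply: ExecSeq ex2 _; apply: ExecSeq ex3 _.
  apply: ExecSeq ex4 _; apply: ExecSeq ex5 _; apply: ExecSeq ex6 _.
  apply: ExecAssign; rewrite /= fr16.1 //.
  by move: rem_le n_le W_gt0; clear; lia.
- have -> : (cost e).+1 = 4 by [].
  have m_sq : size ms <= size ms * size ms by case: (size ms) => // m'; rewrite leq_pmulr.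
  move: le1 le2 le3 le4 le5 le6 m_sq n_gt0; set m := size ms; rewrite -mulnn; clear.
  by lia.
split.
- by rewrite /= fr16.1.
- by rewrite /= fr16.1.
- by move=> i j; rewrite /= fr16.2.
- move=> x; rewrite /= fr6.2 // lab5; congr new_label.
  by rewrite (frame_trans fr1 (frame_trans fr2 (frame_trans fr3 fr4))).2.
move=> h h_le; have := link6 h h_le; rewrite s5g => h6.
transitivity (link s6 h); first by [].
rewrite h6; case: eqP => // _; rewrite /link fr05.1 // !fr05.2 //.
Qed.

End Pieces.

(** One round changes the contents of three slots: g and the two slots of v. *)
Lemma sum_update3 (N : nat) (F F1 : nat -> nat) (a b c : nat) :
  a < N -> b < N -> c < N -> a != b -> a != c -> b != c ->
  (forall i, i < N -> i != a -> i != b -> i != c -> F i = F1 i) ->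
  \sum_(i < N) F i + (F1 a + F1 b + F1 c) = \sum_(i < N) F1 i + (F a + F b + F c).
Proof.
move=> aN bN cN ab ac bc FF1.
have split3 (H : nat -> nat) : \sum_(i < N) H i =
    H a + (H b + (H c + \sum_(i < N | (i != a :> nat) && (i != b :> nat) && (i != c :> nat)) H i)).
  rewrite (bigD1 (Ordinal aN)) //= (bigD1 (Ordinal bN)) /=; last by rewrite -val_eqE /= eq_sym.
  rewrite (bigD1 (Ordinal cN)) /=; last by rewrite -!val_eqE /= ![c == _]eq_sym ac.
  by [].
rewrite (split3 F) (split3 F1).
have -> : \sum_(i < N | (i != a :> nat) && (i != b :> nat) && (i != c :> nat)) F i =
          \sum_(i < N | (i != a :> nat) && (i != b :> nat) && (i != c :> nat)) F1 i.
  by apply: eq_bigr => i /andP[/andP[ia ib] ic]; exact: FF1.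
by lia.
Qed.

(** * Correctness of the program *)

Section Rounds.
Variables (W n : nat) (G : rel 'I_n).
Hypotheses (n_gt0 : 0 < n) (W_ge : 10 * n * n <= W) (tG : tournament G).
Implicit Types (s : store).

Definition unplaced s := [pred u : 'I_n | arr s aLab u <= 2 * n].

(** The slots of a vertex that has not been placed are neither used as labels
    nor written to. *)
Definition fresh_slots s := forall v, v \in unplaced s ->
  (forall u : 'I_n, arr s aLab u != v.+1 /\ arr s aLab u != n + v.+1) /\
  (link n s v.+1 = 0 /\ link n s (n + v.+1) = 0).

(** A slot that belongs to the part of the tree built so far. *)
Definition live s h := forall v : 'I_n, (h = v.+1) \/ (h = n + v.+1) -> v \notin unplaced s.

(** Up to a constant factor, the time that the quadratic parts of the remaining
    rounds may take. *)
Definition potential s := \sum_(g < (2 * n).+1) size (members n s g) ^ 2.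

Definition slot_tree s' h (ms : seq 'I_n) (T : bintree 'I_n) :=
  [/\ perm_eq (inorder T) ms, shortcut_tree G T, pivoted G T &
      links (arr s' aL) (arr s' aR) (link n s' h) T].

Lemma links_node s' (v : 'I_n) l r h : link n s' h = v.+1 ->
  links (arr s' aL) (arr s' aR) (link n s' v.+1) l ->
  links (arr s' aL) (arr s' aR) (link n s' (n + v.+1)) r ->
  links (arr s' aL) (arr s' aR) (link n s' h) (Node l v r).
Proof.
move=> -> ; rewrite {1}/link /= ltn_ord => tl.
rewrite {1}/link addnS /= -addnS ifF; last by rewrite leqNgt; have := ltn_ord v; lia.
by rewrite addKn.
Qed.

Section OneRound.
Variables (s s1 : store) (g : nat) (v : 'I_n).
Hypotheses (s_ok : round_store G s) (s_fresh : fresh_slots s).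
Hypotheses (g_le : g <= 2 * n) (v_ms : v \in members n s g).
Hypothesis step : round_step G s g v s1.
Let ms := members n s g.

Lemma pivot_lab : arr s aLab v = g.
Proof. by move: v_ms; rewrite mem_filter => /andP[/eqP]. Qed.

Lemma pivot_unplaced : v \in unplaced s.
Proof. by rewrite inE pivot_lab. Qed.

Lemma g_slot : g != v.+1 /\ g != n + v.+1.
Proof. by have [/(_ v)] := s_fresh pivot_unplaced; rewrite pivot_lab. Qed.

Lemma lab1E (u : 'I_n) : arr s1 aLab u = new_label G ms v u (arr s aLab u).
Proof. by case: step. Qed.

Lemma in_ms u : (u \in ms) = (arr s aLab u == g).
Proof. by rewrite mem_filter mem_enum andbT. Qed.

Lemma members_pivot : members n s1 g = [::].
Proof.
have [g1 g2] := g_slot.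
rewrite /members (@eq_in_filter _ _ pred0) ?filter_pred0 // => u _ /=.
rewrite lab1E /new_label in_ms; case: (boolP (arr s aLab u == g)) => [_|/negbTE //].
apply/negbTE; case: ifP => _; first by move: g_le; clear; lia.
by case: ifP => _; rewrite eq_sym.
Qed.

Lemma members_left : members n s1 v.+1 = inn G ms v.
Proof.
transitivity (seq.filter (predI (G^~ v) (fun u : 'I_n => arr s aLab u == g)) (enum 'I_n)).
  2: by rewrite filter_predI.
apply: eq_in_filter => u _ /=.
rewrite lab1E /new_label in_ms; have v_lt := ltn_ord v.
case: (boolP (arr s aLab u == g)) => [_|_] /=; last first.
  have [/(_ u) [/negbTE -> _] _] := s_fresh pivot_unplaced.
  by rewrite andbF.
rewrite andbT; case: (eqVneq u v) => [->|_].
  by rewrite tG.1; apply/negbTE; move: v_lt; clear; lia.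
by case: (G u v); move: v_lt; clear; lia.
Qed.

Lemma members_right : members n s1 (n + v.+1) = outn G ms v.
Proof.
transitivity (seq.filter (predI (G v) (fun u : 'I_n => arr s aLab u == g)) (enum 'I_n)).
  2: by rewrite filter_predI.
apply: eq_in_filter => u _ /=.
rewrite lab1E /new_label in_ms; have v_lt := ltn_ord v.
case: (boolP (arr s aLab u == g)) => [_|_] /=; last first.
  have [/(_ u) [_ /negbTE ->] _] := s_fresh pivot_unplaced.
  by rewrite andbF.
rewrite andbT; case: (eqVneq u v) => [->|/tG.2].
  by rewrite tG.1; apply/negbTE; move: v_lt; clear; lia.
by case: (G u v); case: (G v u) => //= _; move: v_lt; clear; lia.
Qed.

Lemma members_other h : h <= 2 * n -> h != g -> h != v.+1 -> h != n + v.+1 ->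
  members n s1 h = members n s h.
Proof.
move=> h_le hg h1 h2; rewrite /members; apply: eq_in_filter => u _ /=.
rewrite lab1E /new_label in_ms; case: (boolP (arr s aLab u == g)) => // /eqP ->.
rewrite [g == h]eq_sym (negbTE hg); apply/negbTE.
case: ifP => _; first by move: h_le; clear; lia.
by case: ifP => _; rewrite eq_sym.
Qed.

Lemma unplaced_step u : (u \in unplaced s1) = (u != v) && (u \in unplaced s).
Proof.
have v_lt := ltn_ord v.
rewrite !inE lab1E /new_label in_ms; case: (boolP (arr s aLab u == g)) => [/eqP ->|ne].
  rewrite g_le; case: eqP => _ /=; first by lia.
  by case: (G u v); move: v_lt; clear; lia.
by case: (eqVneq u v) ne => [->|//]; rewrite pivot_lab eqxx.
Qed.

Lemma round_store_step : round_store G s1.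
Proof.
case: s_ok => _ _ lab_le; case: step => s1N _ s1A _ _; split=> // u.
rewrite lab1E /new_label; case: ifP => // _; case: ifP => // _.
by have := ltn_ord v; case: ifP; clear; lia.
Qed.

Lemma link_step h : h <= 2 * n -> link n s1 h = if h == g then v.+1 else link n s h.
Proof. by case: step => _ _ _ _; exact. Qed.

Lemma fresh_step : fresh_slots s1.
Proof.
move=> w; rewrite unplaced_step => /andP[wv w_un].
have w_lt := ltn_ord w; have v_lt := ltn_ord v.
have [w_lab [w1 w2]] := s_fresh w_un.
have [wg1 wg2] := w_lab v; rewrite pivot_lab in wg1 wg2.
have wv' : nat_of_ord w != v by [].
rewrite !link_step; [|by move: w_lt; clear; lia..].
rewrite ![_ == g]eq_sym (negbTE wg1) (negbTE wg2); split=> // u.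
rewrite lab1E /new_label; case: ifP => _; last exact: w_lab.
case: ifP => _; first by move: w_lt; clear; lia.
by case: ifP => _; move: w_lt v_lt wv'; clear; lia.
Qed.

Lemma live_step h : live s h -> live s1 h.
Proof. by move=> lv w /lv; rewrite unplaced_step negb_and => ->; rewrite orbT. Qed.

Lemma live_left : live s1 v.+1.
Proof.
move=> w [] e; rewrite unplaced_step negb_and; apply/orP; left; rewrite negbK; apply/eqP/val_inj => /=.
  by case: e.
by have := ltn_ord v; move: e; lia.
Qed.

Lemma live_right : live s1 (n + v.+1).
Proof.
move=> w [] e; rewrite unplaced_step negb_and; apply/orP; left; rewrite negbK; apply/eqP/val_inj => /=.
  by have := ltn_ord w; move: e; lia.
by move: e; lia.
Qed.

(** With l and r vertices on the two sides, the pivot condition and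
    e(left, right) <= l r give l ^ 2 + r ^ 2 <= 4 l r + l + r: no pivot is very
    unbalanced, and a round is paid for by the drop
    (l + r + 1) ^ 2 - l ^ 2 - r ^ 2 of the potential. *)
Lemma potential_step : pivot_test G ms v ->
  size ms ^ 2 + 3 * potential s1 <= 3 * potential s.
Proof.
move=> piv; have v_lt := ltn_ord v; have [g1 g2] := g_slot.
have uniq_ms : uniq ms by rewrite filter_uniq ?enum_uniq.
have := @sum_update3 (2 * n).+1 (fun h => size (members n s h) ^ 2) (fun h => size (members n s1 h) ^ 2)
  g v.+1 (n + v.+1).
rewrite -/(potential s) -/(potential s1) members_pivot members_left members_right.
have [/eqP s_left /eqP s_right] : members n s v.+1 == [::] /\ members n s (n + v.+1) == [::].
  have [fr _] := s_fresh pivot_unplaced.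
  by split; rewrite -size_eq0 size_filter -leqn0 leqNgt -has_count;
    apply/hasPn => u _ /=; case: (fr u).
rewrite s_left s_right -/ms /= => sumE.
move: piv; rewrite (pivot_testE tG.1 tG.2 uniq_ms v_ms).
have := cross_le G (inn G ms v) (outn G ms v).
have sz := size_nbrs tG.1 tG.2 uniq_ms v_ms; rewrite sz.
set l := size (inn G ms v) in sz sumE *; set r := size (outn G ms v) in sz sumE *.
set e := cross _ _ _ => e_le piv.
have {}sumE : potential s + (0 + l ^ 2 + r ^ 2) = potential s1 + ((l + r).+1 ^ 2 + 0 + 0).
  rewrite sumE //.
  - by rewrite sz.
  - by move: v_lt; clear; lia.
  - by move: v_lt; clear; lia.
  - by move: v_lt; clear; lia.
  by move=> h h_lt hg h1 h2; rewrite members_other.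
move: sumE piv e_le; rewrite -!mulnn; clear.
set p := potential s; set p1 := potential s1; nia.
Qed.

(** The trees in the final memory s' are assembled backwards in time: if the
    rounds after s1 fill every live slot with a tree of its vertices, then the
    trees of the two slots of v and v itself form the tree of the slot g. The
    link stored in g is never changed again because no vertex is left there. *)
Lemma slot_trees_step s' : pivot_test G ms v ->
  (forall h, h <= 2 * n -> live s1 h ->
     if members n s1 h is [::] then link n s' h = link n s1 h
     else exists T, slot_tree s' h (members n s1 h) T) ->
  forall h, h <= 2 * n -> live s h ->
     if members n s h is [::] then link n s' h = link n s h
     else exists T, slot_tree s' h (members n s h) T.
Proof.
move=> piv IH h h_le h_live; have v_lt := ltn_ord v; have [g1 g2] := g_slot.
have uniq_ms : uniq ms by rewrite filter_uniq ?enum_uniq.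
have [hg|hg] := eqVneq h g; last first.
  have h1 : h != v.+1.
    apply/eqP => hv; have := h_live v (or_introl hv); by rewrite pivot_unplaced.
  have h2 : h != n + v.+1.
    apply/eqP => hv; have := h_live v (or_intror hv); by rewrite pivot_unplaced.
  have := IH h h_le (live_step h_live).
  by rewrite members_other // link_step // (negbTE hg).
subst h.
have child k : k <= 2 * n -> k != g -> live s1 k -> link n s k = 0 ->
    exists T, slot_tree s' k (members n s1 k) T.
  move=> k_le kg k_live k0; have := IH k k_le k_live.
  case: (members n s1 k) => [|x ys] // kE; exists Leaf; split=> //=.
  by rewrite kE link_step // (negbTE kg).
have [_ [l0 r0]] := s_fresh pivot_unplaced.
have [||l [pl tl bl kl]] := child v.+1 _ _ live_left l0; [by move: v_lt; clear; lia|by rewrite eq_sym|].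
have [||r [pr tr br kr]] := child (n + v.+1) _ _ live_right r0; [by move: v_lt; clear; lia|by rewrite eq_sym|].
have gE : link n s' g = v.+1.
  by have := IH g g_le (live_step h_live); rewrite members_pivot link_step // eqxx.
suff treeg : exists T, slot_tree s' g (members n s g) T.
  by move: v_ms treeg; case: (members n s g).
rewrite members_left in pl; rewrite members_right in pr.
exists (Node l v r); split.
- rewrite (permPr (perm_nbrs tG.1 tG.2 uniq_ms v_ms)) /=.
  by apply: perm_cat => //; rewrite perm_cons.
- by rewrite /= tl tr (perm_all _ pl) (perm_all _ pr) !filter_all.
- rewrite /= bl br (perm_size pl) (perm_size pr) (perm_cross G pl pr).
  by rewrite -(pivot_testE tG.1 tG.2 uniq_ms v_ms) piv.
exact: links_node.
Qed.

End OneRound.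

Lemma rounds_ok j s : round_store G s -> fresh_slots s ->
  var s vRem = j -> #|unplaced s| = j ->
  terminates W (While (Var vRem) place_one) s
    (j * (300 * n + 2) + 900 * potential s + 2)
    (fun s' => forall h, h <= 2 * n -> live s h ->
     if members n s h is [::] then link n s' h = link n s h
     else exists T, slot_tree s' h (members n s h) T).
Proof.
have n_W : n <= W by move: W_ge n_gt0; clear; nia.
elim: j s => [|j IHj] s s_ok s_fresh remE unE.
  exists 2, s; split; [|by lia|].
    by apply: ExecWhileEnd; rewrite /= remE.
  move=> h h_le _; have -> // : members n s h = [::].
  rewrite /members (@eq_in_filter _ _ pred0) ?filter_pred0 // => u _ /=.
  apply/negbTE; have := card0_eq unE u; rewrite !inE => /negbT.
  by apply: contra => /eqP ->.
have rem_le : var s vRem <= n by rewrite remE -unE -[leqRHS]card_ord max_card.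
have ex_un : exists u : 'I_n, arr s aLab u <= 2 * n.
  have /card_gt0P [u] : 0 < #|unplaced s| by rewrite unE.
  by rewrite inE; exists u.
have [g [v [g_le v_ms piv [k1 [s1 [ex1 le1 step]]]]]] := place_one_ok n_gt0 W_ge tG s_ok rem_le ex_un.
have s1_ok := round_store_step s_ok step.
have s1_fresh := fresh_step s_fresh g_le v_ms step.
have rem1 : var s1 vRem = j by case: step => _ -> _ _ _; rewrite remE subn1.
have un1 : #|unplaced s1| = j.
  apply: eq_add_S; rewrite -unE [RHS](cardD1 v) (pivot_unplaced g_le v_ms) add1n; congr _.+1.
  apply: eq_card => u; rewrite (unplaced_step g_le v_ms step) !inE //.
have [k2 [s2 [ex2 le2 trees]]] := IHj s1 s1_ok s1_fresh rem1 un1.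
exists (1 + k1 + k2).+1, s2; split.
- apply: (@ExecWhileStep _ (Var vRem) _ _ s1) => //=; last by rewrite remE.
  by rewrite andbT (leq_trans rem_le).
- have := potential_step s_fresh g_le v_ms step piv.
  move: le1 le2; clear; rewrite mulSn; set m := size _ ^ 2; set p := potential s; set p1 := potential s1.
  by move=> h1 h2 h3; lia.
exact: (slot_trees_step s_fresh g_le v_ms step piv).
Qed.

End Rounds.

Lemma input_adj n (G : rel 'I_n) (i j : 'I_n) : arr (input G) aAdj (i * n + j) = G i j.
Proof.
rewrite /=; congr (nat_of_bool _); apply/idP/idP => [/existsP[a /existsP[b /andP[/eqP e Gab]]]|Gij].
  have := congr1 (modn^~ n) e; have := congr1 (divn^~ n) e.
  rewrite !modnMDl !divnMDl ?(leq_ltn_trans _ (ltn_ord i)) // !divn_small // !modn_small // !addn0.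
  by move=> /val_inj -> /val_inj ->.
by apply/existsP; exists i; apply/existsP; exists j; rewrite eqxx.
Qed.

Lemma build_tree_ok n (G : rel 'I_n) : 0 < n -> tournament G ->
  exists k s T,
    [/\ exec (10 * n ^ 10) build_tree (input G) k s, k <= 1500 * n ^ 2,
        output s T & spanning_shortcut_tree G T && pivoted G T].
Proof.
move=> n_gt0 tG; set W := 10 * n ^ 10.
have W_ge : 10 * n * n <= W.
  by rewrite -mulnA leq_mul2l /= mulnn leq_pexp2l.
pose s0 := set_var (input G) vRem n.
have s0_ok : round_store G s0.
  by split=> [//|i j|u]; [exact: input_adj | rewrite /= addn1].
have s0_fresh : fresh_slots n s0.
  move=> v _; split; first by move=> u; split; rewrite /= ?addnS.
  by rewrite /link /= addnS /=; split; case: ifP.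
have s0_un : #|unplaced n s0| = n.
  by rewrite (eq_card (B := predT)) ?card_ord // => u; rewrite !inE.
have mem0 : members n s0 0 = enum 'I_n.
  by rewrite /members (@eq_in_filter _ _ predT) ?filter_predT.
have pot0 : potential n s0 = n ^ 2.
  rewrite /potential big_ord_recl mem0 -cardE card_ord big1 ?addn0 // => g _.
  by rewrite /members (@eq_in_filter _ _ pred0) ?filter_pred0.
have [k [s [ex le trees]]] := rounds_ok n_gt0 W_ge tG s0_ok s0_fresh (erefl _) s0_un.
have live0 : live n s0 0 by move=> v []; rewrite ?addnS.
have := trees 0 isT live0; rewrite mem0.
have [i0] : exists i0 : 'I_n, i0 \in enum 'I_n by exists (Ordinal n_gt0); rewrite mem_enum.
case enumE : (enum 'I_n) => [|x xs] // _ [T [pT tT bT lT]].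
exists (2 + k).+1, s, T; split=> //.
- apply: (@ExecSeq _ _ _ _ s0) => //.
  apply: (@ExecAssign _ (input G) vRem (Var vN)) => /=.
  by rewrite andbT (leq_trans _ W_ge) // -mulnA mulnCA leq_pmulr // muln_gt0.
- have n_sq : n <= n * n by rewrite leq_pmulr.
  have remE : var s0 vRem = n by [].
  by move: le n_gt0 n_sq; rewrite pot0 remE -mulnn; clear; lia.
by rewrite /spanning_shortcut_tree /spanning enumE pT tT.
Qed.

Lemma tree_algorithm (R : realType) :
  quadratic_time_algorithm (fun (n : nat) (G : rel 'I_n) (T : bintree 'I_n) =>
    spanning_shortcut_tree G T /\
    (2^-1 * 'C(n, 2)%:R + n%:R * ln n%:R / 5 - 3122
      <= (shortcuts G T)%:R :> R)%R).
Proof.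
exists build_tree, 1500, 10 => n G n_gt0 tG.
have [k [s [T [ex le_k out /andP[sT bT]]]]] := build_tree_ok n_gt0 tG.
exists k, s, T; split=> //; split=> //.
case/andP: sT => /perm_size pT tT.
by have := pivoted_shortcuts R tT bT; rewrite pT -cardE card_ord.
Qed.

(** * The theorem *)

Local Open Scope ring_scope.

Theorem theorem1p3 (R : realType) :
  [/\ forall n : nat, (1 <= n)%N ->
        2^-1 * 'C(n, 2)%:R + n%:R * ln n%:R / 5 - 3122 <= (t n)%:R :> R,
      quadratic_time_algorithm (fun (n : nat) (G : rel 'I_n) (T : bintree 'I_n) =>
        spanning_shortcut_tree G T /\
        2^-1 * 'C(n, 2)%:R + n%:R * ln n%:R / 5 - 3122
          <= (shortcuts G T)%:R :> R)
    & exists N : nat, forall n : nat, (N <= n)%N ->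
        (t n)%:R <= 2^-1 * 'C(n, 2)%:R + 4 * n%:R * (log2 n%:R) ^+ 2 :> R].
Proof.
split; first exact: t_ge; first exact: tree_algorithm.
by exists (2 ^ 21)%N; exact: t_le_log.
Qed.
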